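(* Let $k$ be a field and let $\mathcal{QA}$ be the category of quadratic algebras over $k$. For $A\leftrightarrow\{A_1,R(A)\}$ and $B\leftrightarrow\{B_1,R(B)\}$ in $\mathcal{QA}$ put $$A\bullet B\leftrightarrow\{A_1\otimes B_1,\ S_{23}(R(A)\otimes R(B))\},\qquad A^!\leftrightarrow\{A_1^*,\ R(A)^\perp\}.$$ Then the following hold. (i) $(\mathcal{QA},\bullet,\mathbf 1)$ is a monoidal category whose unit object is the algebra of dual numbers $\mathbf 1:=k[\tau]/(\tau^2)$. (ii) The map $A\mapsto A^!$ extends to a duality functor $D_K:\mathcal{QA}\to\mathcal{QA}^{op}$ with dualizing object $K:=k[t]=\mathbf 1^!$, so that $(\mathcal{QA},\bullet,\mathbf 1,K)$ is a Grothendieck--Verdier category. (iii) The respective white product $A\circ B:=D_K^{-1}(D_KB\bullet D_KA)$ is given explicitly by $$A\circ B\leftrightarrow\{A_1\otimes B_1,\ S_{23}(R(A)\otimes B_1^{\otimes 2}+A_1^{\otimes 2}\otimes R(B))\}.$$ Its unit object is $K$, and the canonical functorial morphism $A\bullet B\to A\circ B$, compatible with the respective associativity constraints, is induced by the obvious embedding $$R(A\bullet B)=S_{23}(R(A)\otimes R(B))\subset S_{23}(R(A)\otimes B_1^{\otimes 2}+A_1^{\otimes 2}\otimes R(B))=R(A\circ B).$$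
   Context: All tensor products are over the field $k$. Quadratic algebras. An object $A$ of $\mathcal{QA}$ is an associative graded $k$-algebra $A=\bigoplus_{i\ge 0}A_i$ such that $A_0=k$, $A_1$ generates $A$ over $k$, and the ideal of all relations between elements of $A_1$ is generated by its subspace of quadratic relations $R(A)\subset A_1^{\otimes 2}$. This is summarised by writing $A\leftrightarrow\{A_1,R(A)\}$. A morphism $f:A\to B$ is a morphism of graded algebras that is the identity on $k$; morphisms $A\to B$ are in bijection with linear maps $f_1:A_1\to B_1$ such that $(f_1\otimes f_1)(R(A))\subset R(B)$. The variables $\tau$ and $t$ have degree $1$. Notation. $S_{23}:A_1^{\otimes 2}\otimes B_1^{\otimes 2}\to(A_1\otimes B_1)^{\otimes 2}$ is the linear map sending $a_1\otimes a_2\otimes b_1\otimes b_2$ to $a_1\otimes b_1\otimes a_2\otimes b_2$. $A_1^*$ is the space of linear functions $A_1\to k$, and $R(A)^\perp$ is the subspace of $(A_1^* )^{\otimes 2}$ orthogonal to $R(A)$. Grothendieck--Verdier categories. Let $(\mathcal M,\bullet,\mathbf 1)$ be a monoidal category. An antiequivalence functor $D_K:\mathcal M\to\mathcal M^{op}$ is called a duality functor if there exists an object $K$ of $\mathcal M$ such that for every object $Y$ the functor $X\mapsto\mathrm{Hom}(X\bullet Y,K)$ is representable by $D_KY$. In this case $K$ is called a dualizing object, and $(\mathcal M,\bullet,\mathbf 1,K)$ is called a Grothendieck--Verdier category. In a Grothendieck--Verdier category the formula $X\circ Y:=D_K^{-1}(D_KY\bullet D_KX)$ defines a second monoidal structure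 (the white product) with unit object $K$.
   Formalization: The quadratic algebras are assumed to have finite-dimensional A_1 (hence all A_i); without this (ii) fails, since a dual space A_1^* never has countably infinite dimension, so A ↦ A^! is not an antiequivalence. *)

(* Defs.v *)
From HB Require Import structures.
From mathcomp Require Import all_boot all_order all_algebra.
From mathcomp Require Import boolp.

Set Implicit Arguments.
Unset Strict Implicit.
Unset Printing Implicit Defensive.

Import GRing.Theory.
Local Open Scope ring_scope.

Section Linfun.
Variables (k : fieldType) (V W : vectType k).

Lemma linfE (f : V -> W) (lf : linear f) x : linfun f x = f x.
Proof.
pose F : {linear V -> W} := HB.pack f (GRing.isLinear.Build k V W _ f lf).
exact: (lfunE F x).
Qed.

End Linfun.

Section Tensor.
Variable k : fieldType.
Implicit Types U V W : vectType k.

Definition dual V : vectType k := 'Hom(V, k^o).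

(* For finite dimensional spaces, V (x) W is realised as Hom(V^*, W), with    *)
(* v (x) w the map phi |-> phi(v) w; see tliftE and tens_ext for the          *)
(* universal property.                                                        *)
Definition tens V W : vectType k := 'Hom(dual V, W).

Definition ptens V W (v : V) (w : W) : tens V W :=
  linfun (fun phi : dual V => (phi v : k) *: w).

Definition bilin V W U (f : V -> W -> U) : Prop :=
  (forall w, linear (f^~ w)) /\ (forall v, linear (f v)).

(* The linear map out of V (x) W induced by f, meaningful for f bilinear.     *)
Definition tlift V W U (f : V -> W -> U) : 'Hom(tens V W, U) :=
  linfun (fun t : tens V W => \sum_(i < \dim {:V})
    f (vbasis {:V})`_i (t (linfun (coord (vbasis {:V}) i : V -> k^o)))).

Lemma ptensE V W (v : V) (w : W) (phi : dual V) :
  ptens v w phi = (phi v : k) *: w.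
Proof.
by rewrite linfE // => a x y; rewrite add_lfunE scale_lfunE scalerDl scalerA.
Qed.

Lemma ptens_bilin V W : bilin (@ptens V W).
Proof.
split=> [w a x y|v a x y]; apply/lfunP=> phi.
  by rewrite add_lfunE scale_lfunE !ptensE linearP scalerDl scalerA.
by rewrite add_lfunE scale_lfunE !ptensE scalerDr !scalerA mulrC.
Qed.

Lemma ptens_linl V W (a : k) (x y : V) (w : W) :
  ptens (a *: x + y) w = a *: ptens x w + ptens y w.
Proof. exact: (ptens_bilin V W).1. Qed.

Lemma ptens_linr V W (a : k) (v : V) (x y : W) :
  ptens v (a *: x + y) = a *: ptens v x + ptens v y.
Proof. exact: (ptens_bilin V W).2. Qed.

Lemma tlift_linear V W U (f : V -> W -> U) : bilin f ->
  linear (fun t : tens V W => \sum_(i < \dim {:V})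
    f (vbasis {:V})`_i (t (linfun (coord (vbasis {:V}) i : V -> k^o)))).
Proof.
move=> [_ lf] a x y; rewrite scaler_sumr -big_split; apply: eq_bigr => i _ /=.
by rewrite add_lfunE scale_lfunE lf.
Qed.

Lemma tlift_sum V W U (f : V -> W -> U) t : bilin f ->
  tlift f t = \sum_(i < \dim {:V})
    f (vbasis {:V})`_i (t (linfun (coord (vbasis {:V}) i : V -> k^o))).
Proof. by move=> lf; rewrite /tlift (linfE (tlift_linear lf)). Qed.

Lemma tliftE V W U (f : V -> W -> U) v w : bilin f ->
  tlift f (ptens v w) = f v w.
Proof.
move=> bf; have [lf rf] := bf.
have f0 u : f 0 u = 0.
  by have := lf u (-1) 0 0; rewrite scaler0 addr0 scaleN1r addNr.
have fZl a x u : f (a *: x) u = a *: f x u.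
  by have := lf u a x 0; rewrite f0 !addr0.
have fZr a x u : f x (a *: u) = a *: f x u.
  have f0r : f x 0 = 0.
    by have := rf x (-1) 0 0; rewrite scaler0 addr0 scaleN1r addNr.
  by have := rf x a u 0; rewrite f0r !addr0.
have fD x y u : f (x + y) u = f x u + f y u.
  by have := lf u 1 x y; rewrite !scale1r.
rewrite tlift_sum //.
rewrite {2}(coord_vbasis (memvf v)).
have -> (r : seq 'I_(\dim {:V})) (F : 'I_(\dim {:V}) -> V) :
    f (\sum_(i <- r) F i) w = \sum_(i <- r) f (F i) w.
  elim: r => [|i r IH]; first by rewrite !big_nil f0.
  by rewrite !big_cons fD IH.
apply: eq_bigr => i _; rewrite ptensE fZr fZl; congr (_ *: _).
by rewrite linfE // => a x y; rewrite linearP.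
Qed.

Lemma tens_sum V W (t : tens V W) : t = \sum_(i < \dim {:V})
  ptens (vbasis {:V})`_i (t (linfun (coord (vbasis {:V}) i : V -> k^o))).
Proof.
apply/lfunP=> phi; rewrite sum_lfunE.
under eq_bigr do rewrite ptensE -linearZ.
rewrite -linear_sum; congr (t _); apply/lfunP=> v.
rewrite sum_lfunE {1}(coord_vbasis (memvf v)) linear_sum.
apply: eq_bigr => i _; rewrite linearZ scale_lfunE linfE; last first.
  by move=> a x y; rewrite linearP.
by rewrite /GRing.scale /= mulrC.
Qed.

Lemma tens_ext V W U (f g : 'Hom(tens V W, U)) :
  (forall v w, f (ptens v w) = g (ptens v w)) -> f = g.
Proof.
move=> fg; apply/lfunP=> t; rewrite (tens_sum t).
by rewrite !linear_sum; apply: eq_bigr => i _; apply: fg.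
Qed.

Definition tensmap V V' W W' (f : 'Hom(V, V')) (g : 'Hom(W, W')) :
  'Hom(tens V W, tens V' W') := tlift (fun v w => ptens (f v) (g w)).

(* The image of U1 (x) U2 in V (x) W, for subspaces U1 of V and U2 of W.      *)
Definition tensv V W (U1 : {vspace V}) (U2 : {vspace W}) :
    {vspace tens V W} :=
  <<[seq ptens u1 u2 | u1 <- vbasis U1, u2 <- vbasis U2]>>%VS.

Definition S23 V W :
    'Hom(tens (tens V V) (tens W W), tens (tens V W) (tens V W)) :=
  tlift (fun x y => tlift (fun v1 v2 => tlift (fun w1 w2 =>
    ptens (ptens v1 w1) (ptens v2 w2)) y) x).

(* <f1 (x) f2, v1 (x) v2> = f1(v1) f2(v2).                                    *)
Definition tpair V : 'Hom(tens (dual V) (dual V), dual (tens V V)) :=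
  tlift (fun f1 f2 : dual V =>
    tlift (fun v1 v2 => (f1 v1 : k) * f2 v2 : k^o) : dual (tens V V)).

Definition orth V (R : {vspace tens V V}) :
    {vspace tens (dual V) (dual V)} :=
  lker (linfun (fun x => (tpair V x \o projv R)%VF)).

End Tensor.

Section TensorTheory.
Variable k : fieldType.
Implicit Types U V W : vectType k.

Lemma bilin_sum V W U (f : V -> W -> U) (c : k) f' :
  bilin f -> bilin f' -> bilin (fun v w => c *: f v w + f' v w).
Proof.
move=> [lf rf] [lf' rf']; split=> [w|v] a x y /=.
  by rewrite (lf w a x y) (lf' w a x y) !scalerDr !scalerA (mulrC c) addrACA.
by rewrite (rf v a x y) (rf' v a x y) !scalerDr !scalerA (mulrC c) addrACA.
Qed.

Lemma tlift_lin V W U (f f' g : V -> W -> U) (c : k) t :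
  bilin f -> bilin f' -> (forall v w, g v w = c *: f v w + f' v w) ->
  tlift g t = c *: tlift f t + tlift f' t.
Proof.
move=> bf bf' gE; have bg : bilin g.
  have [l r] := bilin_sum c bf bf'.
  by split=> [w|v] a x y; rewrite !gE; [exact: l | exact: r].
have -> : tlift g = c *: tlift f + tlift f'.
  apply: tens_ext => v w.
  by rewrite add_lfunE scale_lfunE !tliftE.
by rewrite add_lfunE scale_lfunE.
Qed.

Lemma bilin_ptens V V' W W' (f : V -> V') (g : W -> W') :
  linear f -> linear g -> bilin (fun v w => ptens (f v) (g w)).
Proof.
move=> lf lg; have [lp rp] := ptens_bilin V' W'.
by split=> [w|v] a x y; rewrite ?lf ?lg; [exact: lp | exact: rp].
Qed.

Lemma tensmapE V V' W W' (f : 'Hom(V, V')) (g : 'Hom(W, W')) v w :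
  tensmap f g (ptens v w) = ptens (f v) (g w).
Proof. by rewrite tliftE //; apply: bilin_ptens => a x y; rewrite linearP. Qed.

Lemma mem_tensv V W (U1 : {vspace V}) (U2 : {vspace W}) u1 u2 :
  u1 \in U1 -> u2 \in U2 -> ptens u1 u2 \in tensv U1 U2.
Proof.
have [lp rp] := ptens_bilin V W; move=> U1u U2u.
have half v2 : v2 \in vbasis U2 -> forall v1, v1 \in U1 ->
    ptens v1 v2 \in tensv U1 U2.
  move=> U2v; suff /subvP sU :
      (U1 <= linfun (ptens (W := W)^~ v2) @^-1: tensv U1 U2)%VS.
    by move=> v1 /sU; rewrite -memv_preim linfE.
  rewrite -{1}(span_basis (vbasisP U1)); apply/span_subvP => v U1v.
  by rewrite -memv_preim linfE //; apply/memv_span/allpairs_f.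
suff /subvP/(_ _ U2u) : (U2 <= linfun (ptens u1) @^-1: tensv U1 U2)%VS.
  by rewrite -memv_preim linfE.
rewrite -{1}(span_basis (vbasisP U2)); apply/span_subvP => v U2v.
by rewrite -memv_preim linfE //; apply: half.
Qed.

Lemma tensv_subP V W (U1 : {vspace V}) (U2 : {vspace W})
    (X : {vspace tens V W}) :
  (tensv U1 U2 <= X)%VS <->
  (forall u1 u2, u1 \in U1 -> u2 \in U2 -> ptens u1 u2 \in X).
Proof.
split=> [/subvP sX u1 u2 U1u U2u|sX]; first by apply/sX/mem_tensv.
apply/span_subvP=> _ /allpairsP[[u1 u2] /= [u1P u2P ->]].
by apply: sX; apply: vbasis_mem.
Qed.

Lemma S23E V W (v1 v2 : V) (w1 w2 : W) :
  S23 V W (ptens (ptens v1 v2) (ptens w1 w2)) =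
  ptens (ptens v1 w1) (ptens v2 w2).
Proof.
have b0 x1 x2 : bilin (fun w1 w2 : W => ptens (ptens x1 w1) (ptens x2 w2)).
  by split=> [w|v] a x y; rewrite ?(ptens_linl, ptens_linr).
have b1 (y : tens W W) : bilin (fun v1 v2 : V => tlift (fun w1 w2 =>
    ptens (ptens v1 w1) (ptens v2 w2)) y).
  split=> [x2|x1] a x y'; apply: tlift_lin => // v w.
    by rewrite !ptens_linl.
  by rewrite ptens_linl ptens_linr.
rewrite tliftE; first by rewrite tliftE // tliftE.
split=> [y|x] a z1 z2; first by rewrite linearP.
by apply: tlift_lin => // v w; rewrite linearP.
Qed.

Lemma tpairE V (f1 f2 : dual V) v1 v2 :
  tpair V (ptens f1 f2) (ptens v1 v2) = (f1 v1 : k) * f2 v2.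
Proof.
have b0 (g1 g2 : dual V) :
    bilin (fun v1 v2 : V => (g1 v1 : k) * g2 v2 : k^o).
  split=> [x2|x1] a x y; rewrite linearP /GRing.scale /=.
    by rewrite mulrDl mulrA.
  by rewrite mulrDr mulrCA.
rewrite tliftE ?tliftE //.
split=> [g2|g1] a x y; apply/lfunP=> t;
  rewrite add_lfunE scale_lfunE; apply: tlift_lin => // v w.
  by rewrite add_lfunE scale_lfunE /GRing.scale /= mulrDl mulrA.
by rewrite add_lfunE scale_lfunE /GRing.scale /= mulrDr mulrCA.
Qed.

Lemma mem_orth V (R : {vspace tens V V}) x :
  x \in orth R <-> (forall r, r \in R -> tpair V x r = 0).
Proof.
rewrite memv_ker linfE; last first.
  move=> a y z; apply/lfunP=> t.
  by rewrite !(add_lfunE, scale_lfunE, comp_lfunE) linearP add_lfunE scale_lfunE.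
split=> [/eqP/lfunP x0 r Rr|x0].
  by have := x0 r; rewrite comp_lfunE zero_lfunE projv_id.
by apply/eqP/lfunP=> r; rewrite comp_lfunE zero_lfunE x0 ?memv_proj.
Qed.

End TensorTheory.

(* Graded k-algebras with finite dimensional components. The product          *)
(* A_i x A_j -> A_n is indexed by a proof of i + j = n, so that associativity *)
(* and the right unit law need no transport.                                  *)
Record gralg (k : fieldType) := Gralg {
  gr :> nat -> vectType k;
  gmul : forall i j n, (i + j)%N = n -> gr i -> gr j -> gr n;
  gone : gr 0%N;
  gmul_linl : forall i j n (e : (i + j)%N = n) b,
    linear (fun a => gmul e a b);
  gmul_linr : forall i j n (e : (i + j)%N = n) a, linear (gmul e a);
  gmulA : forall i j l ij jl n (e1 : (i + j)%N = ij) (e2 : (ij + l)%N = n)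
    (e3 : (j + l)%N = jl) (e4 : (i + jl)%N = n) a b c,
    gmul e2 (gmul e1 a b) c = gmul e4 a (gmul e3 b c);
  gmul1l : forall n (e : (0 + n)%N = n) a, gmul e gone a = a;
  gmul1r : forall n (e : (n + 0)%N = n) a, gmul e a gone = a }.

Record gmor (k : fieldType) (A B : gralg k) := Gmor {
  gmap :> forall n, 'Hom(A n, B n);
  gmor1 : gmap 0%N (gone A) = gone B;
  gmorM : forall i j n (e : (i + j)%N = n) (a : A i) (b : A j),
    gmap n (gmul e a b) = gmul e (gmap i a) (gmap j b) }.

Section GradedAlgebra.
Variable k : fieldType.
Implicit Types A B C : gralg k.

Lemma gmor_eq A B (f g : gmor A B) : (forall n x, f n x = g n x) -> f = g.
Proof.
move=> fg; have {fg}E : gmap f = gmap g.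
  by apply: functional_extensionality_dep => n; apply/lfunP.
case: f g E => [f f1 fM] [g g1 gM] /= E; case: _ / E in g1 gM *.
by congr Gmor; apply: Prop_irrelevance.
Qed.

Lemma gmor_id_subproof1 A : (\1%VF : 'End(A 0%N)) (gone A) = gone A.
Proof. by rewrite id_lfunE. Qed.

Lemma gmor_id_subproof2 A i j n (e : (i + j)%N = n) (a : A i) (b : A j) :
  (\1%VF : 'End(A n)) (gmul e a b)
  = gmul e ((\1%VF : 'End(A i)) a) ((\1%VF : 'End(A j)) b).
Proof. by rewrite !id_lfunE. Qed.

Definition gmor_id A : gmor A A :=
  Gmor (gmor_id_subproof1 A) (@gmor_id_subproof2 A).

Lemma gmor_comp_subproof1 A B C (g : gmor B C) (f : gmor A B) :
  (g 0%N \o f 0%N)%VF (gone A) = gone C.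
Proof. by rewrite comp_lfunE !gmor1. Qed.

Lemma gmor_comp_subproof2 A B C (g : gmor B C) (f : gmor A B) i j n
    (e : (i + j)%N = n) (a : A i) (b : A j) :
  (g n \o f n)%VF (gmul e a b)
  = gmul e ((g i \o f i)%VF a) ((g j \o f j)%VF b).
Proof. by rewrite !comp_lfunE !gmorM. Qed.

Definition gmor_comp A B C (g : gmor B C) (f : gmor A B) : gmor A C :=
  Gmor (gmap := fun n => (g n \o f n)%VF)
    (gmor_comp_subproof1 g f) (gmor_comp_subproof2 g f).

(* The two-sided ideal of A generated by a subspace S of A_d.                 *)
Inductive ideal_gen A (d : nat) (S : {vspace A d}) :
    forall n, A n -> Prop :=
| IdealGen s : s \in S -> ideal_gen S s
| Ideal0 n : ideal_gen S (0 : A n)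
| IdealD n (x y : A n) : ideal_gen S x -> ideal_gen S y -> ideal_gen S (x + y)
| IdealMl i j n (e : (i + j)%N = n) (a : A i) (x : A j) :
    ideal_gen S x -> ideal_gen S (gmul e a x)
| IdealMr i j n (e : (i + j)%N = n) (x : A i) (a : A j) :
    ideal_gen S x -> ideal_gen S (gmul e x a).

Section Quotient.
Variables (A : gralg k) (I : forall n, A n -> Prop).
Arguments I {n}.

Definition submodule (V : vectType k) (P : V -> Prop) :=
  P 0 /\ forall c x y, P x -> P y -> P (c *: x + y).

Lemma submodule_vspace (V : vectType k) (P : V -> Prop) :
  submodule P -> exists U : {vspace V}, forall x, x \in U <-> P x.
Proof.
move=> [P0 PD].
pose Q d := `[< exists U : {vspace V}, (forall x, x \in U -> P x) /\ \dim U = d >].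
have exQ : exists d, Q d.
  exists 0%N; apply/asboolP; exists 0%VS; rewrite dimv0; split=> // x.
  by rewrite memv0 => /eqP ->.
have ubQ d : Q d -> (d <= \dim {:V})%N.
  by move=> /asboolP[U [_ <-]]; apply/dimvS/subvf.
case: (ex_maxnP exQ ubQ) => d /asboolP[U [UP dU]] dmax.
exists U => x; split=> [/UP //|Px].
have /dmax : Q (\dim (U + <[x]>)).
  apply/asboolP; exists (U + <[x]>)%VS; split=> // y.
  move=> /memv_addP[u Uu [_ /vlineP[c ->] ->]].
  by rewrite addrC; apply: PD => //; apply: UP.
rewrite -dU => le; have := dimv_leqif_sup (addvSl U <[x]>).
case=> _; rewrite eqn_leq le dimvS ?addvSl //= => /esym/subvP; apply.
by apply: (subvP (addvSr U <[x]>)); apply: memv_line.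
Qed.

Record gideal : Prop := Gideal {
  gideal_sub : forall n, submodule (@I n);
  gidealMl : forall i j n (e : (i + j)%N = n) (a : A i) (x : A j),
    I x -> I (gmul e a x);
  gidealMr : forall i j n (e : (i + j)%N = n) (x : A i) (a : A j),
    I x -> I (gmul e x a) }.

Hypothesis idI : gideal.

Definition ideal_vspace n : {vspace A n} :=
  projT1 (cid (submodule_vspace (gideal_sub idI n))).

Lemma ideal_vspaceP n (x : A n) : x \in ideal_vspace n <-> I x.
Proof. exact: (projT2 (cid (submodule_vspace (gideal_sub idI n)))). Qed.

(* The quotient of A_n by I_n, realised on a complement of I_n.               *)
Definition quot_gr n : vectType k := subvs_of (ideal_vspace n)^C%VS.

Definition quot_proj n : 'Hom(A n, quot_gr n) :=
  linfun (fun x => vsproj (ideal_vspace n)^C%VS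
    (daddv_pi (ideal_vspace n)^C (ideal_vspace n) x)).

Definition quot_repr n : quot_gr n -> A n := vsval.

Lemma quot_projE n x : quot_repr (quot_proj n x)
  = daddv_pi (ideal_vspace n)^C (ideal_vspace n) x.
Proof.
rewrite /quot_repr linfE ?vsprojK ?memv_pi //.
by move=> a u v; rewrite !linearP.
Qed.

Lemma quot_reprK n : cancel (@quot_repr n) (quot_proj n).
Proof.
move=> x; apply: subvs_inj; rewrite [vsval _]quot_projE daddv_pi_id ?subvsP //.
by rewrite capvC capv_compl.
Qed.

Lemma quot_proj_eq0 n (x : A n) : quot_proj n x = 0 <-> I x.
Proof.
rewrite -ideal_vspaceP.
have dis : ((ideal_vspace n)^C :&: ideal_vspace n = 0)%VS.
  by rewrite capvC capv_compl.
have xE := daddv_pi_add dis (w := x).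
split=> [x0|Ix].
  rewrite -xE ?[(_^C + _)%VS]addvC ?addv_complf ?memvf //.
  by rewrite -quot_projE x0 [quot_repr 0]linear0 add0r memv_pi.
apply: subvs_inj; rewrite [vsval _]quot_projE linear0.
apply/eqP; rewrite -memv0 -dis memv_cap memv_pi /=.
have -> : daddv_pi (ideal_vspace n)^C (ideal_vspace n) x
   = x - daddv_pi (ideal_vspace n) (ideal_vspace n)^C x.
  apply/eqP; rewrite eq_sym subr_eq xE //.
  by rewrite addvC addv_complf memvf.
by rewrite memvB ?memv_pi.
Qed.

Lemma quot_proj_repr n (x : A n) : I (quot_repr (quot_proj n x) - x).
Proof. by apply/quot_proj_eq0; rewrite linearB /= quot_reprK subrr. Qed.

Definition quot_mul i j n (e : (i + j)%N = n) (a : quot_gr i)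
    (b : quot_gr j) : quot_gr n :=
  quot_proj n (gmul e (quot_repr a) (quot_repr b)).

Lemma gmulBl i j n (e : (i + j)%N = n) (a a' : A i) (b : A j) :
  gmul e (a - a') b = gmul e a b - gmul e a' b.
Proof. by rewrite addrC -scaleN1r (gmul_linl e b) scaleN1r addrC. Qed.

Lemma gmulBr i j n (e : (i + j)%N = n) (a : A i) (b b' : A j) :
  gmul e a (b - b') = gmul e a b - gmul e a b'.
Proof. by rewrite addrC -scaleN1r (gmul_linr e a) scaleN1r addrC. Qed.

Lemma quot_mulE i j n (e : (i + j)%N = n) (a : A i) (b : A j) :
  quot_mul e (quot_proj i a) (quot_proj j b) = quot_proj n (gmul e a b).
Proof.
apply/eqP; rewrite -subr_eq0 -linearB; apply/eqP/quot_proj_eq0.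
rewrite -(subrKA (gmul e a (quot_repr (quot_proj j b)))) -gmulBl -gmulBr.
have [_ D] := gideal_sub idI n; rewrite -[X in X + _]scale1r; apply: D.
  exact/(gidealMr idI)/quot_proj_repr.
exact/(gidealMl idI)/quot_proj_repr.
Qed.

Lemma quot_ind n (P : quot_gr n -> Prop) :
  (forall x, P (quot_proj n x)) -> forall a, P a.
Proof. by move=> Pp a; rewrite -(quot_reprK a). Qed.

Lemma quot_linl i j n (e : (i + j)%N = n) b : linear ((quot_mul e)^~ b).
Proof.
move=> c; elim/quot_ind: b => b; elim/quot_ind=> x; elim/quot_ind=> y.
by rewrite -linearP !quot_mulE (gmul_linl e b) linearP.
Qed.

Lemma quot_linr i j n (e : (i + j)%N = n) a : linear (quot_mul e a).
Proof.
move=> c; elim/quot_ind: a => b; elim/quot_ind=> x; elim/quot_ind=> y.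
by rewrite -linearP !quot_mulE (gmul_linr e b) linearP.
Qed.

Lemma quot_mulA i j l ij jl n (e1 : (i + j)%N = ij) (e2 : (ij + l)%N = n)
    (e3 : (j + l)%N = jl) (e4 : (i + jl)%N = n) a b c :
  quot_mul e2 (quot_mul e1 a b) c = quot_mul e4 a (quot_mul e3 b c).
Proof.
elim/quot_ind: a => a; elim/quot_ind: b => b; elim/quot_ind: c => c.
by rewrite !quot_mulE (gmulA e1 e2 e3 e4).
Qed.

Lemma quot_mul1l n (e : (0 + n)%N = n) a :
  quot_mul e (quot_proj 0 (gone A)) a = a.
Proof. by elim/quot_ind: a => a; rewrite quot_mulE gmul1l. Qed.

Lemma quot_mul1r n (e : (n + 0)%N = n) a :
  quot_mul e a (quot_proj 0 (gone A)) = a.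
Proof. by elim/quot_ind: a => a; rewrite quot_mulE gmul1r. Qed.

Definition gquot : gralg k :=
  Gralg quot_linl quot_linr quot_mulA quot_mul1l quot_mul1r.

End Quotient.

Lemma gmulZl A i j n (e : (i + j)%N = n) c (a : A i) (b : A j) :
  gmul e (c *: a) b = c *: gmul e a b.
Proof.
have z : gmul e (0 : A i) b = 0 by rewrite -(subrr 0) gmulBl subrr.
by rewrite -[c *: a]addr0 (gmul_linl e b) z addr0.
Qed.

Lemma ideal_gen_ideal A d (S : {vspace A d}) : gideal (@ideal_gen A d S).
Proof.
split=> [n|i j n e a x|i j n e x a].
- split=> [|c x y Ix Iy]; first exact: Ideal0.
  apply: IdealD Iy; rewrite -(gmul1l (add0n n) x) -gmulZl.
  exact: IdealMl.
- exact: IdealMl.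
exact: IdealMr.
Qed.

End GradedAlgebra.

Section TensorAlgebra.
Variables (k : fieldType) (V : vectType k).

Fixpoint tpow (n : nat) : vectType k :=
  if n is n'.+1 then tens V (tpow n') else k^o.

Fixpoint tmul i j : tpow i -> tpow j -> tpow (i + j) :=
  match i return tpow i -> tpow j -> tpow (i + j) with
  | 0 => fun c y => (c : k) *: y
  | i'.+1 => fun x y => tlift (fun v x' => ptens v (tmul x' y)) x
  end.

Definition tpow_mul i j n (e : (i + j)%N = n) (x : tpow i) (y : tpow j) :
  tpow n := ecast n (tpow n) e (tmul x y).

Lemma tmul_lin i j :
  (forall y : tpow j, linear (fun x : tpow i => tmul x y)) /\
  (forall x : tpow i, linear (@tmul i j x)).
Proof.
elim: i => [|i [IHl IHr]] /=.
  split=> [y|x] a u v; first by rewrite scalerDl scalerA.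
  by rewrite scalerDr !scalerA mulrC.
have b (y : tpow j) : bilin (fun v (x' : tpow i) => ptens v (tmul x' y)).
  by apply: bilin_ptens => // a u v.
split=> [y|x] a u v; first by rewrite linearP.
by apply: tlift_lin => // w x'; rewrite IHr ptens_linr.
Qed.

Lemma tmul_consE i j v (x : tpow i) (y : tpow j) :
  tmul (ptens v x : tpow i.+1) y = ptens v (tmul x y).
Proof.
rewrite /= tliftE //; apply: bilin_ptens => // a u w.
exact: (tmul_lin i j).1.
Qed.

Lemma tpow_mul_consE i j n (e : (i + j)%N = n) (e' : (i.+1 + j)%N = n.+1) v
    (x : tpow i) (y : tpow j) :
  tpow_mul e' (ptens v x : tpow i.+1) y = ptens v (tpow_mul e x y).
Proof.
rewrite /tpow_mul; case: _ / e in e' *.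
by rewrite (eq_irrelevance e' (erefl _)) tmul_consE.
Qed.

Lemma tpow_mul0 n (e : (0 + n)%N = n) (c : tpow 0) (x : tpow n) :
  tpow_mul e c x = (c : k) *: x.
Proof. by rewrite (eq_irrelevance e (erefl _)). Qed.

Lemma tpow_linl i j n (e : (i + j)%N = n) (y : tpow j) :
  linear ((@tpow_mul i j n e)^~ y).
Proof. by case: _ / e; apply: (tmul_lin i j).1. Qed.

Lemma tpow_linr i j n (e : (i + j)%N = n) (x : tpow i) :
  linear (@tpow_mul i j n e x).
Proof. by case: _ / e; apply: (tmul_lin i j).2. Qed.

Lemma tpow_ind n (P : tpow n.+1 -> Prop) :
  P 0 -> (forall x y, P x -> P y -> P (x + y)) ->
  (forall v t, P (ptens v t)) -> forall x, P x.
Proof.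
move=> P0 PD Pp x; rewrite (tens_sum x).
by apply: big_rec => // i y _ Py; apply: PD.
Qed.

Lemma tpow_mulA i j l ij jl n (e1 : (i + j)%N = ij) (e2 : (ij + l)%N = n)
    (e3 : (j + l)%N = jl) (e4 : (i + jl)%N = n) a b c :
  tpow_mul e2 (tpow_mul e1 a b) c = tpow_mul e4 a (tpow_mul e3 b c).
Proof.
case: _ / e1 e2; case: _ / e3 e4.
elim: i n a => [|i IH] n a e4 e2.
  case: _ / e4 e2 => e2.
  rewrite (eq_irrelevance e2 (erefl _)) /=.
  have := (tmul_lin j l).1 c (a : k) b 0.
  have -> : tmul (0 : tpow j) c = 0.
    have := (tmul_lin j l).1 c 1 0 0; rewrite !scale1r addr0.
    by rewrite -[X in X = _]addr0 => /addrI/esym.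
  by rewrite !addr0.
case: n => // n in e2 e4 *.
elim/tpow_ind: a => [|x y IHx IHy|v t].
- have z p q m (e : (p + q)%N = m) w : tpow_mul e (0 : tpow p) w = 0.
    have := tpow_linl e w 1 0 0; rewrite !scale1r addr0.
    by rewrite -[X in X = _]addr0 => /addrI/esym.
  by rewrite !z.
- have D p q m (e : (p + q)%N = m) u w z :
      tpow_mul e (u + w : tpow p) z = tpow_mul e u z + tpow_mul e w z.
    by have := tpow_linl e z 1 u w; rewrite !scale1r.
  by rewrite !D IHx IHy.
have e2' : (i + j + l)%N = n := succn_inj e2.
have e4' : (i + (j + l))%N = n := succn_inj e4.
rewrite (tpow_mul_consE (erefl (i + j)%N)) (tpow_mul_consE e2').
by rewrite (tpow_mul_consE e4') (IH _ _ e4').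
Qed.

Lemma tpow_mul1l n (e : (0 + n)%N = n) (a : tpow n) :
  tpow_mul e (1 : k^o) a = a.
Proof. by rewrite tpow_mul0 scale1r. Qed.

Lemma tpow_mul1r n (e : (n + 0)%N = n) (a : tpow n) :
  tpow_mul e a (1 : k^o) = a.
Proof.
elim: n e a => [|n IH] e a.
  by rewrite tpow_mul0 /GRing.scale /= mulr1.
elim/tpow_ind: a => [|x y IHx IHy|v t].
- have := tpow_linl e (1 : k^o) 1 0 0; rewrite !scale1r addr0.
  by rewrite -[X in X = _]addr0 => /addrI/esym.
- have := tpow_linl e (1 : k^o) 1 x y.
  by rewrite !scale1r IHx IHy.
by rewrite (tpow_mul_consE (addn0 n)) IH.
Qed.

Definition tensor_alg : gralg k :=
  Gralg tpow_linl tpow_linr tpow_mulA tpow_mul1l tpow_mul1r.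

(* The identification of V (x) V with the degree 2 component                  *)
(* V (x) (V (x) k) of the tensor algebra.                                     *)
Definition tpow2 : 'Hom(tens V V, tpow 2) :=
  tensmap \1%VF (linfun (fun v => ptens v (1 : k^o) : tpow 1)).

End TensorAlgebra.

Section QuadraticAlgebra.
Variable k : fieldType.

(* The canonical morphism T(A_1) -> A.                                        *)
Fixpoint tens_eval (A : gralg k) n : 'Hom(tpow (A 1%N) n, A n) :=
  match n return 'Hom(tpow (A 1%N) n, A n) with
  | 0 => linfun (fun c : k^o => (c : k) *: gone A)
  | n'.+1 => tlift (fun v t => gmul (add1n n') v (tens_eval A n' t))
  end.

(* R(A), the kernel of the product A_1 (x) A_1 -> A_2.                        *)
Definition quad_rel (A : gralg k) : {vspace tens (A 1%N) (A 1%N)} :=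
  lker (tlift (gmul (add1n 1)) : 'Hom(tens (A 1%N) (A 1%N), A 2%N)).

Record is_quadratic (A : gralg k) : Prop := IsQuadratic {
  quad_deg0 : bijective (fun c : k => c *: gone A);
  quad_generated : forall n (x : A n), exists t, tens_eval A n t = x;
  quad_relations : forall n (t : tpow (A 1%N) n), tens_eval A n t = 0 ->
    ideal_gen (A := tensor_alg (A 1%N)) (tpow2 (A 1%N) @: quad_rel A)%VS t }.

Record QA := MkQA { qa_gr :> gralg k; qa_quadratic : is_quadratic qa_gr }.

End QuadraticAlgebra.

Section TensorAlgebraTheory.
Variable k : fieldType.
Implicit Types (A : gralg k) (U V W : vectType k).

Lemma lfunD V W (f : 'Hom(V, W)) x y : f (x + y) = f x + f y.
Proof. exact: linearD. Qed.

Lemma lfun_lin V W (f : 'Hom(V, W)) a x y : f (a *: x + y) = a *: f x + f y.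
Proof. exact: linearP. Qed.

Lemma lfunZ V W (f : 'Hom(V, W)) a x : f (a *: x) = a *: f x.
Proof. exact: linearZ. Qed.

Lemma lfun0 V W (f : 'Hom(V, W)) : f 0 = 0.
Proof. exact: linear0. Qed.

Lemma gmul_bilin A i j n (e : (i + j)%N = n) : bilin (@gmul k A i j n e).
Proof. by split=> [b|a]; [exact: gmul_linl | exact: gmul_linr]. Qed.

Lemma gmul0 A i j n (e : (i + j)%N = n) (b : A j) : gmul e (0 : A i) b = 0.
Proof. by rewrite -[X in gmul e X b](subrr 0) gmulBl subrr. Qed.

Lemma gmulr0 A i j n (e : (i + j)%N = n) (a : A i) : gmul e a (0 : A j) = 0.
Proof. by rewrite -[X in gmul e a X](subrr 0) gmulBr subrr. Qed.

Lemma gmulZr A i j n (e : (i + j)%N = n) c (a : A i) (b : A j) :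
  gmul e a (c *: b) = c *: gmul e a b.
Proof. by rewrite -[c *: b]addr0 (gmul_linr e a) gmulr0 addr0. Qed.

Lemma gmulDl A i j n (e : (i + j)%N = n) (a a' : A i) (b : A j) :
  gmul e (a + a') b = gmul e a b + gmul e a' b.
Proof. by have := gmul_linl e b 1 a a'; rewrite !scale1r. Qed.

Lemma tens_eval0 A c : tens_eval A 0 c = (c : k) *: gone A.
Proof. by rewrite linfE // => a u v; rewrite scalerDl scalerA. Qed.

Lemma tens_evalS A n v t :
  tens_eval A n.+1 (ptens v t) = gmul (add1n n) v (tens_eval A n t).
Proof.
rewrite tliftE //; split=> [b|a] c x y; first by rewrite (gmul_linl _ _ c x y).
by rewrite linearP (gmul_linr (add1n n) a).
Qed.

Lemma ptens0r V W (v : V) : ptens v (0 : W) = 0.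
Proof. by apply/lfunP=> f; rewrite ptensE scaler0 zero_lfunE. Qed.

Lemma ptens0l V W (w : W) : ptens (0 : V) w = 0.
Proof. by apply/lfunP=> f; rewrite ptensE linear0 scale0r zero_lfunE. Qed.

Lemma ptensZr V W c (v : V) (w : W) : ptens v (c *: w) = c *: ptens v w.
Proof. by rewrite -[c *: w]addr0 ptens_linr ptens0r addr0. Qed.

Lemma ptensZl V W c (v : V) (w : W) : ptens (c *: v) w = c *: ptens v w.
Proof. by rewrite -[c *: v]addr0 ptens_linl ptens0l addr0. Qed.

Lemma ptensDl V W (v v' : V) (w : W) : ptens (v + v') w = ptens v w + ptens v' w.
Proof. by have := ptens_linl 1 v v' w; rewrite !scale1r. Qed.

Lemma tpow1E V (x : tpow V 1) : exists v, x = ptens v (1 : k^o).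
Proof.
elim/tpow_ind: x => [|x y [v ->] [w ->]|v c].
- by exists 0; rewrite ptens0l.
- by exists (v + w); rewrite ptensDl.
exists ((c : k) *: v); rewrite ptensZl -ptensZr; congr (ptens v _).
by rewrite /GRing.scale /= mulr1.
Qed.

Lemma tpow1_inj V : injective (fun v : V => ptens v (1 : k^o)).
Proof.
move=> v w /lfunP E; apply/eqP; rewrite -subr_eq0; apply/eqP.
rewrite (coord_vbasis (memvf (v - w))) big1 // => i _.
suff vw : coord (vbasis {:V}) i v = coord (vbasis {:V}) i w.
  by rewrite linearB /= vw subrr scale0r.
have := E (linfun (coord (vbasis {:V}) i : V -> k^o)).
rewrite !ptensE /GRing.scale /= !mulr1.
by rewrite !linfE => // a x y; rewrite linearP.
Qed.

Lemma tpow1_linear V : linear (fun v : V => ptens v (1 : k^o) : tpow V 1).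
Proof. by move=> a x y; rewrite ptens_linl. Qed.

Lemma tpow2E V (v w : V) :
  tpow2 V (ptens v w) = ptens v (ptens w (1 : k^o)).
Proof.
by rewrite tensmapE id_lfunE linfE //; apply: tpow1_linear.
Qed.

Lemma tpow_mul11 V n (e : (1 + n)%N = n.+1) v (t : tpow V n) :
  tpow_mul e (ptens v (1 : k^o) : tpow V 1) t = ptens v t.
Proof. by rewrite (tpow_mul_consE (add0n n)) tpow_mul1l. Qed.

Lemma tpow_mul0l V i j n (e : (i + j)%N = n) (y : tpow V j) :
  tpow_mul e (0 : tpow V i) y = 0.
Proof. exact: (@gmul0 (tensor_alg V)). Qed.

Lemma tpow_mulDl V i j n (e : (i + j)%N = n) (x x' : tpow V i) (y : tpow V j) :
  tpow_mul e (x + x') y = tpow_mul e x y + tpow_mul e x' y.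
Proof. exact: (@gmulDl (tensor_alg V)). Qed.

Fixpoint tpow_map V W (f : 'Hom(V, W)) n : 'Hom(tpow V n, tpow W n) :=
  if n is n'.+1 return 'Hom(tpow V n, tpow W n)
  then tensmap f (tpow_map f n') else \1%VF.

Lemma tpow_mapS V W (f : 'Hom(V, W)) n v t :
  tpow_map f n.+1 (ptens v t) = ptens (f v) (tpow_map f n t).
Proof. exact: tensmapE. Qed.

Lemma tpow_mapM V W (f : 'Hom(V, W)) i j n (e : (i + j)%N = n) x y :
  tpow_map f n (tpow_mul e x y)
  = tpow_mul e (tpow_map f i x) (tpow_map f j y).
Proof.
elim: i n e x => [|i IH] n e x.
  by rewrite /= id_lfunE; case: _ / e; rewrite !tpow_mul0 linearZ.
case: n e => // n e; elim/tpow_ind: x => [|a b IHa IHb|v t].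
- by rewrite tpow_mul0l !lfun0 tpow_mul0l.
- by rewrite tpow_mulDl !lfunD tpow_mulDl IHa IHb.
rewrite (tpow_mul_consE (succn_inj e)) !tpow_mapS.
by rewrite (tpow_mul_consE (succn_inj e)) IH.
Qed.

Lemma tpow_map_comp U V W (g : 'Hom(V, W)) (f : 'Hom(U, V)) n t :
  tpow_map g n (tpow_map f n t) = tpow_map (g \o f) n t.
Proof.
elim: n t => [|n IH] t; first by rewrite /= !id_lfunE.
elim/tpow_ind: t => [|a b IHa IHb|v t]; rewrite ?lfun0 //.
  by rewrite !lfunD IHa IHb.
by rewrite !tpow_mapS comp_lfunE IH.
Qed.

Lemma tpow_map1 V n t : tpow_map (\1 : 'End(V)) n t = t.
Proof.
elim: n t => [|n IH] t; first by rewrite /= id_lfunE.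
elim/tpow_ind: t => [|a b IHa IHb|v t]; rewrite ?lfun0 ?lfunD ?IHa ?IHb //.
by rewrite tpow_mapS id_lfunE IH.
Qed.

Lemma ideal_gen_lt A d (S : {vspace A d}) n (x : A n) :
  ideal_gen S x -> (n < d)%N -> x = 0.
Proof.
elim=> {n x} [s _|//|n x y _ IHx _ IHy nd|i j n e a x _ IH nd|i j n e x a _ IH nd].
- by rewrite ltnn.
- by rewrite IHx // IHy // addr0.
- by rewrite IH ?gmulr0 // (leq_ltn_trans _ nd) // -e leq_addl.
by rewrite IH ?gmul0 // (leq_ltn_trans _ nd) // -e leq_addr.
Qed.

Lemma ideal_gen_eq_subproof V d (S : {vspace tpow V d}) n (x : tpow V n)
    (e : d = n) : ideal_gen (A := tensor_alg V) S x ->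
  x \in ecast m {vspace tpow V m} e S.
Proof.
move=> Ix; elim: Ix e => {n x}
  [s Ss e|n e|n x y _ IHx _ IHy e|i j n e a x Ix IH de|i j n e x a Ix IH de].
- by rewrite (eq_irrelevance e (erefl _)).
- by rewrite mem0v.
- exact: memvD.
- case: _ / de in e *; have [jd|dj] := ltnP j d.
    by rewrite (ideal_gen_lt Ix jd) gmulr0 mem0v.
  have i0 : 0%N = i by apply/esym/eqP; rewrite -leqn0 -(leq_add2r j) e.
  case: _ / i0 in e a *; have ed : d = j by rewrite -e.
  case: _ / ed in x Ix IH e dj *.
  rewrite -[gmul _ _ _]/(tpow_mul e a x) tpow_mul0.
  exact: memvZ (IH (erefl d)).
case: _ / de in e *; have [jd|dj] := ltnP i d.
  by rewrite (ideal_gen_lt Ix jd) gmul0 mem0v.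
have j0 : 0%N = j by apply/esym/eqP; rewrite -leqn0 -(leq_add2l i) e addn0.
case: _ / j0 in e a *; have ed : d = i by rewrite -e addn0.
case: _ / ed in x Ix IH e dj *.
have -> : a = (a : k) *: (gone (tensor_alg V)) :> tensor_alg V 0%N.
  by rewrite /GRing.scale /= mulr1.
by rewrite gmulZr gmul1r; apply: memvZ (IH (erefl d)).
Qed.

Lemma ideal_gen_eq V d (S : {vspace tpow V d}) (x : tpow V d) :
  ideal_gen (A := tensor_alg V) S x -> x \in S.
Proof. exact: (ideal_gen_eq_subproof (erefl d)). Qed.

End TensorAlgebraTheory.

Section Presented.
Variables (k : fieldType) (V : vectType k) (R : {vspace tens V V}).

(* T(V)/(R).                                                                  *)
Definition pres_gr : gralg k := gquot
  (ideal_gen_ideal (A := tensor_alg V) (d := 2) (tpow2 V @: R)%VS).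

Definition pres_proj n : 'Hom(tpow V n, pres_gr n) := quot_proj
  (ideal_gen_ideal (A := tensor_alg V) (d := 2) (tpow2 V @: R)%VS) n.

(* The canonical isomorphism from V to the degree 1 component of T(V)/(R).    *)
Definition pres_gen : 'Hom(V, pres_gr 1%N) :=
  linfun (fun v => pres_proj 1 (ptens v (1 : k^o))).

Lemma pres_genE v : pres_gen v = pres_proj 1 (ptens v (1 : k^o)).
Proof. by rewrite linfE // => a x y; rewrite (tpow1_linear a x y) linearP. Qed.

Lemma pres_proj_eq0 n (t : tpow V n) : pres_proj n t = 0 <->
  ideal_gen (A := tensor_alg V) (d := 2) (tpow2 V @: R)%VS t.
Proof. exact: quot_proj_eq0. Qed.

Lemma pres_projM i j n (e : (i + j)%N = n) (x : tpow V i) (y : tpow V j) :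
  pres_proj n (tpow_mul e x y)
  = gmul (g := pres_gr) e (pres_proj i x) (pres_proj j y).
Proof. exact/esym/quot_mulE. Qed.

Lemma pres_eval n t :
  tens_eval pres_gr n (tpow_map pres_gen n t) = pres_proj n t.
Proof.
elim: n t => [|n IH] t.
  have -> : tpow_map pres_gen 0 t = t by apply: id_lfunE.
  rewrite tens_eval0 -[gone _]/(pres_proj 0 _) -linearZ; congr (pres_proj _ _).
  by rewrite /GRing.scale /= mulr1.
elim/tpow_ind: t => [|a b IHa IHb|v t]; rewrite ?lfun0 //.
  by rewrite !lfunD IHa IHb.
by rewrite tpow_mapS tens_evalS IH pres_genE -pres_projM tpow_mul11.
Qed.

Lemma pres_gen_bij : bijective pres_gen.
Proof.
have inj : lker pres_gen == 0%VS.
  apply/lker0P => v w E; apply/eqP; rewrite -subr_eq0; apply/eqP.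
  have E0 : pres_proj 1 (ptens (v - w) (1 : k^o)) = 0.
    by apply/eqP; rewrite -pres_genE linearB subr_eq0; apply/eqP.
  have := ideal_gen_lt ((@pres_proj_eq0 1 _).1 E0) isT.
  by rewrite -(ptens0l _ (1 : k^o)) => /tpow1_inj.
exists (pres_gen^-1)%VF; first exact: lker0_lfunK.
move=> x; apply: limg_lfunVK; elim/quot_ind: x => x.
have [v ->] := tpow1E x.
by rewrite -[quot_proj _ _ _]/(pres_proj 1 _) -pres_genE memv_img ?memvf.
Qed.

Lemma pres_mul2 t : tlift (gmul (add1n 1)) (tensmap pres_gen pres_gen t)
  = pres_proj 2 (tpow2 V t).
Proof.
rewrite -!comp_lfunE; congr (fun_of_lfun _ t); apply: tens_ext => v w.
rewrite !comp_lfunE tensmapE tliftE; last exact: gmul_bilin.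
by rewrite !pres_genE -pres_projM tpow_mul11 tpow2E.
Qed.

Lemma pres_inv : exists g : 'Hom(pres_gr 1%N, V),
  (pres_gen \o g = \1)%VF /\ (g \o pres_gen = \1)%VF.
Proof.
have [g' gK Kg] := pres_gen_bij.
have lg : linear g'.
  by move=> a x y; apply: (can_inj gK); rewrite Kg lfun_lin !Kg.
by exists (linfun g'); split; apply/lfunP=> x;
  rewrite comp_lfunE id_lfunE linfE // ?Kg ?gK.
Qed.

Lemma pres_rel : quad_rel pres_gr = (tensmap pres_gen pres_gen @: R)%VS.
Proof.
have [g [jg gj]] := pres_inv.
apply/eqP; rewrite eqEsubv; apply/andP; split; apply/subvP=> x; last first.
  move=> /memv_imgP[r Rr ->]; rewrite memv_ker pres_mul2.
  by apply/eqP/(@pres_proj_eq0 2 _)/IdealGen/memv_img.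
have xE : x = tensmap pres_gen pres_gen (tensmap g g x).
  rewrite -comp_lfunE -[LHS]id_lfunE; congr (fun_of_lfun _ x).
  apply: tens_ext => v w.
  by rewrite comp_lfunE id_lfunE !tensmapE -!comp_lfunE jg !id_lfunE.
rewrite memv_ker xE pres_mul2 => /eqP/(@pres_proj_eq0 2 _)/ideal_gen_eq.
move=> /memv_imgP[r Rr E]; apply: memv_img.
suff -> : tensmap g g x = r by [].
have tpow2_inj : lker (tpow2 V) == 0%VS.
  apply/lker0P.
  suff c : cancel (tpow2 V) (tlift (fun v => tlift (fun w (c : k^o) =>
      (c : k) *: ptens v w))) by exact: can_inj c.
  have b v : bilin (fun w (c : k^o) => (c : k) *: ptens (W := V) (v : V) w).
    split=> [w|c] a y z; first by rewrite ptens_linr scalerDr !scalerA mulrC.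
    by rewrite scalerDl scalerA.
  move=> t; rewrite -comp_lfunE -[RHS]id_lfunE; congr (fun_of_lfun _ t).
  apply: tens_ext => v w; rewrite comp_lfunE id_lfunE tpow2E tliftE.
    by rewrite tliftE // scale1r.
  split=> [t'|u] a y z; last by rewrite linearP.
  by apply: tlift_lin => // w' c; rewrite ptens_linl scalerDr !scalerA mulrC.
by move/lker0P: tpow2_inj; apply.
Qed.

Lemma pres_quadratic : is_quadratic pres_gr.
Proof.
split.
- have E (c : k) : c *: gone pres_gr = pres_proj 0 (c : k^o).
    rewrite -[gone _]/(pres_proj 0 _) -linearZ; congr (pres_proj _ _).
    by rewrite /GRing.scale /= mulr1.
  pose r (a : pres_gr 0%N) : k := quot_repr (a :
    quot_gr (ideal_gen_ideal (A := tensor_alg V) (d := 2) (tpow2 V @: R)%VS) 0).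
  have rK a : pres_proj 0 (r a : k^o) = a by apply: quot_reprK.
  have inj (c c' : k^o) : pres_proj 0 c = pres_proj 0 c' -> c = c'.
    move=> cc'; apply/eqP; rewrite -subr_eq0; apply/eqP.
    have Z : pres_proj 0 (c - c' : k^o) = 0.
      by apply/eqP; rewrite linearB subr_eq0; apply/eqP.
    exact: (ideal_gen_lt ((@pres_proj_eq0 0 _).1 Z) isT).
  by exists r => [c|a]; rewrite E //; apply: inj; rewrite rK.
- move=> n; elim/quot_ind=> t; exists (tpow_map pres_gen n t).
  exact: pres_eval.
move=> n t; have [g [jg gj]] := pres_inv.
have <- : tpow_map pres_gen n (tpow_map g n t) = t.
  by rewrite tpow_map_comp jg tpow_map1.
rewrite pres_eval => /(@pres_proj_eq0 n _); move: (tpow_map g n t) => {}t.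
elim=> {n t} [s Ss|n|n x y _ Ix _ Iy|i j n e a x _ Ix|i j n e x a _ Ix].
- move: Ss => /memv_imgP[r Rr ->]; apply: IdealGen.
  have -> : tpow_map pres_gen 2 (tpow2 V r) =
      tpow2 (pres_gr 1%N) (tensmap pres_gen pres_gen r).
    rewrite -!comp_lfunE; congr (fun_of_lfun _ r); apply: tens_ext => v w.
    rewrite !comp_lfunE tensmapE !tpow2E !tpow_mapS.
    by rewrite /= id_lfunE.
  by apply/memv_img; rewrite pres_rel memv_img.
- by rewrite linear0; apply: Ideal0.
- by rewrite linearD; apply: IdealD.
- by rewrite tpow_mapM; apply: IdealMl.
by rewrite tpow_mapM; apply: IdealMr.
Qed.

Definition pres : QA k := MkQA pres_quadratic.

End Presented.

Section Examples.
Variable k : fieldType.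

(* k[tau]/(tau^2): the component of degree n is k tau^n, that is, k for n < 2 *)
(* and 0 otherwise.                                                           *)
Definition dual_gr n : vectType k := 'rV[k]_(n < 2).

Definition dual_coef n (a : dual_gr n) : k := \sum_s a 0 s.

Definition dual_elt n (c : k) : dual_gr n := const_mx c.

Definition dual_mul i j n of (i + j)%N = n :=
  fun (a : dual_gr i) (b : dual_gr j) => dual_elt n (dual_coef a * dual_coef b).

Lemma dual_coef_lin n c (a b : dual_gr n) :
  dual_coef (c *: a + b) = c * dual_coef a + dual_coef b.
Proof.
rewrite /dual_coef mulr_sumr -big_split; apply: eq_bigr => s _.
by rewrite !mxE.
Qed.

Lemma dual_elt_lin n c x y :
  dual_elt n (c * x + y) = c *: dual_elt n x + dual_elt n y.
Proof. by apply/rowP=> s; rewrite !mxE. Qed.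

Lemma dual_eltK n : (n < 2)%N -> cancel (dual_elt n) (@dual_coef n).
Proof.
move=> n2 c; rewrite /dual_coef /dual_elt n2.
by rewrite big_ord1 mxE.
Qed.

Lemma dual_coefK n : cancel (@dual_coef n) (dual_elt n).
Proof.
move=> a; apply/rowP=> s; rewrite mxE /dual_coef.
move: a s; rewrite /dual_gr; case: (n < 2)%N => a s; last by case: s.
by rewrite big_ord1 !ord1.
Qed.

Lemma dual_eq n (x y : k) : ((n < 2)%N -> x = y) -> dual_elt n x = dual_elt n y.
Proof.
move=> xy; apply/rowP=> s; rewrite !mxE; apply: xy.
by case: (n < 2)%N s => // -[].
Qed.

Lemma dual_linl i j n (e : (i + j)%N = n) b : linear (fun a => @dual_mul i j n e a b).
Proof.
move=> c x y.
by rewrite /dual_mul dual_coef_lin -dual_elt_lin mulrDl mulrA.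
Qed.

Lemma dual_linr i j n (e : (i + j)%N = n) a : linear (@dual_mul i j n e a).
Proof.
move=> c x y.
by rewrite /dual_mul dual_coef_lin -dual_elt_lin mulrDr mulrCA.
Qed.

Lemma dual_mulA i j l ij jl n (e1 : (i + j)%N = ij) (e2 : (ij + l)%N = n)
    (e3 : (j + l)%N = jl) (e4 : (i + jl)%N = n) a b c :
  dual_mul e2 (dual_mul e1 a b) c = dual_mul e4 a (dual_mul e3 b c).
Proof.
apply: dual_eq => n2; rewrite !dual_eltK ?mulrA //.
  by rewrite (leq_ltn_trans _ n2) // -e4 leq_addl.
by rewrite (leq_ltn_trans _ n2) // -e2 leq_addr.
Qed.

Lemma dual_mul1l n (e : (0 + n)%N = n) a : dual_mul e (dual_elt 0 1) a = a.
Proof. by rewrite /dual_mul dual_eltK // mul1r dual_coefK. Qed.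

Lemma dual_mul1r n (e : (n + 0)%N = n) a : dual_mul e a (dual_elt 0 1) = a.
Proof. by rewrite /dual_mul dual_eltK // mulr1 dual_coefK. Qed.

Definition dual_alg : gralg k :=
  Gralg dual_linl dual_linr dual_mulA dual_mul1l dual_mul1r.

Local Notation tau := (dual_elt 1 1 : dual_alg 1%N).

(* k[t], the component of degree n being k t^n.                               *)
Definition poly_gr (n : nat) : vectType k := k^o.

Definition poly_mul i j n of (i + j)%N = n :=
  fun (a : poly_gr i) (b : poly_gr j) => ((a : k) * (b : k) : k) : poly_gr n.

Lemma poly_linl i j n (e : (i + j)%N = n) b : linear (fun a => @poly_mul i j n e a b).
Proof. by move=> c x y; rewrite /poly_mul /GRing.scale /= mulrDl mulrA. Qed.

Lemma poly_linr i j n (e : (i + j)%N = n) a : linear (@poly_mul i j n e a).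
Proof. by move=> c x y; rewrite /poly_mul /GRing.scale /= mulrDr mulrCA. Qed.

Lemma poly_mulA i j l ij jl n (e1 : (i + j)%N = ij) (e2 : (ij + l)%N = n)
    (e3 : (j + l)%N = jl) (e4 : (i + jl)%N = n) a b c :
  poly_mul e2 (poly_mul e1 a b) c = poly_mul e4 a (poly_mul e3 b c).
Proof. exact/esym/mulrA. Qed.

Lemma poly_mul1l n (e : (0 + n)%N = n) a : poly_mul e (1 : poly_gr 0) a = a.
Proof. exact: mul1r. Qed.

Lemma poly_mul1r n (e : (n + 0)%N = n) a : poly_mul e a (1 : poly_gr 0) = a.
Proof. exact: mulr1. Qed.

Definition poly_alg : gralg k :=
  Gralg poly_linl poly_linr poly_mulA poly_mul1l poly_mul1r.

Local Notation poly_t := (1 : k^o).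

Fixpoint tpow_pow (V : vectType k) (u : V) n : tpow V n :=
  if n is n'.+1 return tpow V n then ptens u (tpow_pow u n') else (1 : k^o).

Lemma tpow_line (V : vectType k) (u : V) :
  (forall v, exists c, v = c *: u) ->
  forall n (t : tpow V n), exists c : k, t = c *: tpow_pow u n.
Proof.
move=> Vu; elim=> [|n IH] t.
  by exists (t : k); rewrite /GRing.scale /= mulr1.
elim/tpow_ind: t => [|x y [c ->] [d ->]|v t].
- by exists 0; rewrite scale0r.
- by exists (c + d); rewrite scalerDl.
have [c ->] := Vu v; have [d ->] := IH t.
by exists (c * d); rewrite ptensZl ptensZr scalerA.
Qed.

Lemma dual_line (v : dual_alg 1%N) : exists c, v = c *: tau.
Proof.
exists (dual_coef v); rewrite -[LHS]dual_coefK.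
by apply/rowP=> s; rewrite !mxE mulr1.
Qed.

Lemma dual_eval_pow n : tens_eval dual_alg n (tpow_pow tau n) = dual_elt n 1.
Proof.
elim: n => [|n IH].
  by rewrite (tens_eval0 (A := dual_alg)) scale1r.
rewrite (tens_evalS (A := dual_alg)) IH; apply: dual_eq => n2.
by rewrite !dual_eltK ?mulr1 // (ltn_trans _ n2).
Qed.

Lemma dual_quadratic : is_quadratic dual_alg.
Proof.
split.
- exists (@dual_coef 0) => [c|a].
    have -> : c *: gone dual_alg = dual_elt 0 c.
      by apply/rowP=> s; rewrite !mxE mulr1.
    exact: dual_eltK.
  rewrite -[RHS]dual_coefK.
  by apply/rowP=> s; rewrite !mxE mulr1.
- move=> n x; exists (dual_coef x *: tpow_pow tau n).
  rewrite lfunZ dual_eval_pow -[RHS]dual_coefK.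
  by apply/rowP=> s; rewrite !mxE mulr1.
move=> n t; have [c ->] := tpow_line dual_line t.
case: n t => [|[|n]] t.
- rewrite lfunZ dual_eval_pow => /rowP/(_ 0); rewrite !mxE mulr1 => ->.
  by rewrite scale0r; apply: Ideal0.
- rewrite lfunZ dual_eval_pow => /rowP/(_ 0); rewrite !mxE mulr1 => ->.
  by rewrite scale0r; apply: Ideal0.
move=> _.
have -> : c *: tpow_pow tau n.+2 = gmul (g := tensor_alg (dual_alg 1%N))
   (erefl : (2 + n)%N = n.+2) (tpow2 _ (ptens tau tau)) (c *: tpow_pow tau n).
  rewrite tpow2E gmulZr; congr (_ *: _); rewrite -[RHS]/(tpow_mul _ _ _).
  by rewrite (tpow_mul_consE (erefl (1 + n)%N)) tpow_mul11.
apply/IdealMr/IdealGen/memv_img; rewrite memv_ker.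
by apply/eqP/rowP=> -[].
Qed.

Lemma poly_line (v : poly_alg 1%N) : exists c : k, v = c *: poly_t.
Proof. by exists (v : k); rewrite /GRing.scale /= mulr1. Qed.

Lemma poly_eval_pow n : tens_eval poly_alg n (tpow_pow (poly_t : poly_alg 1%N) n) = (1 : k^o).
Proof.
elim: n => [|n IH]; first by rewrite (tens_eval0 (A := poly_alg)) scale1r.
by rewrite (tens_evalS (A := poly_alg)) IH; apply: mulr1.
Qed.

Lemma poly_quadratic : is_quadratic poly_alg.
Proof.
split.
- by exists id => c; apply: mulr1.
- move=> n x; exists ((x : k) *: tpow_pow (poly_t : poly_alg 1%N) n).
  by rewrite lfunZ poly_eval_pow; apply: mulr1.
move=> n t; have [c ->] := tpow_line poly_line t.
rewrite lfunZ poly_eval_pow /GRing.scale /= mulr1 => ->.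
by rewrite -[X in ideal_gen _ X]/(0 *: tpow_pow (poly_t : poly_alg 1%N) n) scale0r; apply: Ideal0.
Qed.

Definition dual_numbers : QA k := MkQA dual_quadratic.

Definition poly_ring : QA k := MkQA poly_quadratic.

End Examples.

Definition tau (k : fieldType) : dual_numbers k 1%N := dual_elt (k := k) 1 1.

Definition poly_t (k : fieldType) : poly_ring k 1%N := (1 : k^o).

Record category := Category {
  obj :> Type;
  mor : obj -> obj -> Type;
  idm : forall X, mor X X;
  cmp : forall X Y Z, mor Y Z -> mor X Y -> mor X Z;
  cmpA : forall W X Y Z (h : mor Y Z) (g : mor X Y) (f : mor W X),
    cmp h (cmp g f) = cmp (cmp h g) f;
  cmp1l : forall X Y (f : mor X Y), cmp (idm Y) f = f;
  cmp1r : forall X Y (f : mor X Y), cmp f (idm X) = f }.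

Arguments idm {c} X.

Definition opcat (C : category) : category :=
  @Category C (fun X Y => mor Y X) (@idm C) (fun X Y Z g f => cmp f g)
    (fun W X Y Z h g f => esym (cmpA f g h))
    (fun X Y f => cmp1r f) (fun X Y f => cmp1l f).

Definition unop (C : category) (X Y : C) (f : mor (c := opcat C) X Y) :
  mor (c := C) Y X := f.

Record iso (C : category) (X Y : C) := Iso {
  fwd : mor X Y;
  bwd : mor Y X;
  fwdK : cmp bwd fwd = idm X;
  bwdK : cmp fwd bwd = idm Y }.

(* Functor structures on a given map on objects.                              *)
Record functor (C D : category) (F : C -> D) := Functor {
  fmap : forall X Y, mor X Y -> mor (F X) (F Y);
  fmap1 : forall X, fmap (idm X) = idm (F X);
  fmapM : forall X Y Z (g : mor Y Z) (f : mor X Y),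
    fmap (cmp g f) = cmp (fmap g) (fmap f) }.

Record quasi_inverse (C D : category) (F : C -> D) (FF : functor F) :=
  QuasiInverse {
    qinv :> D -> C;
    qinv_functor : functor qinv;
    qunit : forall X, iso X (qinv (F X));
    qunit_nat : forall X X' (f : mor X X'),
      cmp (fwd (qunit X')) f
      = cmp (fmap qinv_functor (fmap FF f)) (fwd (qunit X));
    qcounit : forall Y, iso (F (qinv Y)) Y;
    qcounit_nat : forall Y Y' (g : mor Y Y'),
      cmp g (fwd (qcounit Y))
      = cmp (fwd (qcounit Y')) (fmap FF (fmap qinv_functor g)) }.

(* Monoidal structures with a given tensor product on objects and a given     *)
(* unit object.                                                               *)
Record monoidal (C : category) (ten : C -> C -> C) (one : C) := Monoidal {
  tmap : forall X X' Y Y', mor X X' -> mor Y Y' -> mor (ten X Y) (ten X' Y');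
  tmap1 : forall X Y, tmap (idm X) (idm Y) = idm (ten X Y);
  tmapM : forall X X' X'' Y Y' Y'' (f' : mor X' X'') (f : mor X X')
      (g' : mor Y' Y'') (g : mor Y Y'),
    tmap (cmp f' f) (cmp g' g) = cmp (tmap f' g') (tmap f g);
  assoc : forall X Y Z, iso (ten (ten X Y) Z) (ten X (ten Y Z));
  assoc_nat : forall X X' Y Y' Z Z' (f : mor X X') (g : mor Y Y')
      (h : mor Z Z'),
    cmp (fwd (assoc X' Y' Z')) (tmap (tmap f g) h)
    = cmp (tmap f (tmap g h)) (fwd (assoc X Y Z));
  lunit : forall X, iso (ten one X) X;
  lunit_nat : forall X X' (f : mor X X'),
    cmp (fwd (lunit X')) (tmap (idm one) f) = cmp f (fwd (lunit X));
  runit : forall X, iso (ten X one) X;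
  runit_nat : forall X X' (f : mor X X'),
    cmp (fwd (runit X')) (tmap f (idm one)) = cmp f (fwd (runit X));
  pentagon : forall W X Y Z,
    cmp (fwd (assoc W X (ten Y Z))) (fwd (assoc (ten W X) Y Z))
    = cmp (tmap (idm W) (fwd (assoc X Y Z)))
        (cmp (fwd (assoc W (ten X Y) Z))
           (tmap (fwd (assoc W X Y)) (idm Z)));
  triangle : forall X Y,
    cmp (tmap (idm X) (fwd (lunit Y))) (fwd (assoc X one Y))
    = tmap (fwd (runit X)) (idm Y) }.

Section GrothendieckVerdier.
Variables (C : category) (ten : C -> C -> C) (one : C).
Variables (M : monoidal ten one) (K : C).

(* Z represents the functor X |-> Hom(X . Y, K).                              *)
Definition represents (Y Z : C) : Prop :=
  exists Phi : forall X, mor (ten X Y) K -> mor X Z,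
    (forall X, bijective (Phi X)) /\
    (forall X X' (g : mor X X') (f : mor (ten X' Y) K),
      Phi X (cmp f (tmap M g (idm Y))) = cmp (Phi X' f) g).

Definition antiequivalence (D0 : C -> C)
    (D : functor (C := C) (D := opcat C) D0) : Prop :=
  inhabited (quasi_inverse D).

(* D is a duality functor with dualizing object K.                            *)
Definition duality_functor (D0 : C -> C)
    (D : functor (C := C) (D := opcat C) D0) : Prop :=
  antiequivalence D /\ (forall Y, represents Y (D0 Y)).

Definition grothendieck_verdier : Prop :=
  exists (D0 : C -> C) (D : functor (C := C) (D := opcat C) D0),
    duality_functor D.

Section WhiteProduct.
Variables (D0 : C -> C) (D : functor (C := C) (D := opcat C) D0).
Variable E : quasi_inverse D.

Definition white (X Y : C) : C := E (ten (D0 Y) (D0 X)).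

Definition white_map X X' Y Y' (f : mor X X') (g : mor Y Y') :
    mor (white X Y) (white X' Y') :=
  fmap (qinv_functor E) (tmap M (fmap D g) (fmap D f)
    : mor (c := opcat C) (ten (D0 Y) (D0 X)) (ten (D0 Y') (D0 X'))).

(* The comparison D(X o Y) -> DY . DX.                                        *)
Definition white_cmp (X Y : C) : mor (D0 (white X Y)) (ten (D0 Y) (D0 X)) :=
  unop (bwd (qcounit E (ten (D0 Y) (D0 X)))).

(* W is the monoidal structure on the white product transported along D:      *)
(* D, with the comparison above and some comparison DK = 1 of the units,      *)
(* takes W to the reverse of M.                                               *)
Definition white_structure (W : monoidal white K) : Prop :=
  [/\ (forall X X' Y Y' (f : mor X X') (g : mor Y Y'),
        tmap W f g = white_map f g),
      (forall X Y Z,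
        cmp (tmap M (idm (D0 Z)) (white_cmp X Y))
          (cmp (white_cmp (white X Y) Z) (unop (fmap D (fwd (assoc W X Y Z)))))
        = cmp (fwd (assoc M (D0 Z) (D0 Y) (D0 X)))
            (cmp (tmap M (white_cmp Y Z) (idm (D0 X)))
               (white_cmp X (white Y Z))))
    & exists u : iso (D0 K) one, forall X,
        cmp (fwd (runit M (D0 X)))
          (cmp (tmap M (idm (D0 X)) (fwd u))
             (cmp (white_cmp K X) (unop (fmap D (fwd (lunit W X))))))
        = idm (D0 X) /\
        cmp (fwd (lunit M (D0 X)))
          (cmp (tmap M (fwd u) (idm (D0 X)))
             (cmp (white_cmp X K) (unop (fmap D (fwd (runit W X))))))
        = idm (D0 X)].

End WhiteProduct.
End GrothendieckVerdier.

Section QuadraticCategory.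
Variable k : fieldType.
Implicit Types A B : QA k.

Lemma gmor_compA (A B C D : QA k) (h : gmor C D) (g : gmor B C)
    (f : gmor A B) : gmor_comp h (gmor_comp g f) = gmor_comp (gmor_comp h g) f.
Proof. by apply: gmor_eq => n x; rewrite /= !comp_lfunE. Qed.

Lemma gmor_comp1l (A B : QA k) (f : gmor A B) : gmor_comp (gmor_id B) f = f.
Proof. by apply: gmor_eq => n x; rewrite /= comp_lfunE id_lfunE. Qed.

Lemma gmor_comp1r (A B : QA k) (f : gmor A B) : gmor_comp f (gmor_id A) = f.
Proof. by apply: gmor_eq => n x; rewrite /= comp_lfunE id_lfunE. Qed.

Definition QA_category : category :=
  @Category (QA k) (fun A B => gmor A B) (fun A => gmor_id A)
    (fun A B C g f => gmor_comp g f) gmor_compA gmor_comp1l gmor_comp1r.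

(* A <-> {V, R}, through the isomorphism g from V to A_1.                     *)
Definition presents A (V : vectType k) (R : {vspace tens V V})
    (g : 'Hom(V, A 1%N)) : Prop :=
  bijective g /\ (tensmap g g @: R)%VS = quad_rel A.

Lemma pres_presents (V : vectType k) (R : {vspace tens V V}) :
  presents (A := pres R) R (pres_gen R).
Proof. by split; [exact: pres_gen_bij | rewrite pres_rel]. Qed.

Definition bullet_rel A B :
    {vspace tens (tens (A 1%N) (B 1%N)) (tens (A 1%N) (B 1%N))} :=
  (S23 (A 1%N) (B 1%N) @: tensv (quad_rel A) (quad_rel B))%VS.

Definition bullet A B : QA k := pres (bullet_rel A B).

(* The element a (x) b of (A . B)_1.                                          *)
Definition bul A B (a : A 1%N) (b : B 1%N) : bullet A B 1%N :=
  pres_gen (bullet_rel A B) (ptens a b).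

Definition shriek A : QA k := pres (orth (quad_rel A)).

(* The element f of (A^!)_1.                                                  *)
Definition shr A (f : dual (A 1%N)) : shriek A 1%N :=
  pres_gen (orth (quad_rel A)) f.

Definition white_rel A B :
    {vspace tens (tens (A 1%N) (B 1%N)) (tens (A 1%N) (B 1%N))} :=
  (S23 (A 1%N) (B 1%N) @: (tensv (quad_rel A) fullv + tensv fullv (quad_rel B)))%VS.

End QuadraticCategory.

Canonical QA_category.

(* Main.v *)
Require Import Defs.
From mathcomp Require Import all_boot all_order all_algebra.

Set Implicit Arguments.
Unset Strict Implicit.
Unset Printing Implicit Defensive.

Import GRing.Theory.
Local Open Scope ring_scope.

(* A morphism of quadratic algebras is the same as a linear map in degree 1   *)
(* preserving the quadratic relations, so every equation between morphisms is *)
(* checked on degree 1 generators, and every morphism is built there.         *)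
(* The black and the white product are treated at once: both are presented by *)
(* A_1 (x) B_1 with relations spanned by the S23(x (x) y) such that x \in     *)
(* R(A) and (respectively or) y \in R(B). Associativity and monotonicity of   *)
(* the connective give the associativity constraint and functoriality.        *)
(* The quasi-inverse E of the duality D is arbitrary, so the degree 1         *)
(* component of the white product E(DB . DA) is only known through its dual,  *)
(* B_1^* (x) A_1^* via the counit. Transposing identifies it with A_1 (x)     *)
(* B_1, and biduality for subspaces, (R_B^0 (x) R_A^0)^0 = R_A (x) 1 + 1 (x)  *)
(* R_B, gives its relations.                                                  *)

(** * Tensors and duals of finite dimensional spaces *)

Section LinearAlgebra.
Variable k : fieldType.
Implicit Types U V W : vectType k.

(** By [gmor_eq1], [gmor_lift] and [gmor_rel], a morphism A -> B amounts to a linear map A_1 -> B_1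
    carrying R(A) into R(B). What remains is the linear algebra of finite dimensional spaces V with
    a subspace R of V (x) V.

    Products. By [pr_lift], a bilinear map on A_1 and B_1 extends to the product as soon as it sends
    the spanning relations to relations. The relations of either bracketing of a triple product are
    spanned by rearranged tensors x (x) y (x) z, under conditions that agree because the connective
    is associative. The unit is a line whose square is a relation for [andb] (dual numbers) and is
    not one for [orb] (k[t]). Both monoidal structures are instances of [product_monoidal].

    Duality. Since K has one generator and no relations, a morphism X . Y -> K is a form b on X_1
    (x) Y_1 such that b (x) b vanishes on S23(R(X) (x) R(Y)). Equivalently, the curried map from X_1
    to the dual of Y_1 carries R(X) into the orthogonal of R(Y), which is a morphism X -> Y^!
    ([curry], [uncurry]). Double orthogonals ([mem_orthK]) make ! its own quasi-inverse.

    White product. The counit identifies (E(DB . DA))^! with DB . DA. Transposing this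
    identification gives generators A_1 (x) B_1 and the stated relations ([om_presents]). The [orb]
    structure on this presentation is the transported one ([white_structureP]), and [andb] implying
    [orb] gives the canonical morphism ([black_to_white]). *)

Lemma hom_bij_lker0 V W (f : 'Hom(V, W)) : bijective f -> lker f == 0%VS.
Proof. by move=> [g fK _]; apply/lker0P/(can_inj fK). Qed.

Lemma hom_bijK V W (f : 'Hom(V, W)) : bijective f -> cancel f (f^-1)%VF.
Proof. by move=> /hom_bij_lker0 f0; apply: lker0_lfunK. Qed.

Lemma hom_bijVK V W (f : 'Hom(V, W)) : bijective f -> cancel (f^-1)%VF f.
Proof.
move=> bf y; have [g _ gK] := bf; apply: limg_lfunVK.
by rewrite -(gK y) memv_img ?memvf.
Qed.

Lemma tens_ind V W (P : tens V W -> Prop) :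
  P 0 -> (forall x y, P x -> P y -> P (x + y)) ->
  (forall v w, P (ptens v w)) -> forall t, P t.
Proof.
move=> P0 PD Pp t; rewrite (tens_sum t).
by apply: big_rec => // i x _ Px; apply: PD.
Qed.

Lemma ptensDr V W (v : V) (w w' : W) :
  ptens v (w + w') = ptens v w + ptens v w'.
Proof. by have := ptens_linr 1 v w w'; rewrite !scale1r. Qed.

Lemma ptens_homl V W U (f : 'Hom(tens V W, U)) w :
  linear (fun v => f (ptens v w)).
Proof. by move=> a x y; rewrite ptens_linl linearP. Qed.

Lemma ptens_homr V W U (f : 'Hom(tens V W, U)) v :
  linear (fun w => f (ptens v w)).
Proof. by move=> a x y; rewrite ptens_linr linearP. Qed.

Lemma tensmap_comp V V' V'' W W' W'' (f' : 'Hom(V', V'')) (f : 'Hom(V, V'))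
    (g' : 'Hom(W', W'')) (g : 'Hom(W, W')) t :
  tensmap f' g' (tensmap f g t) = tensmap (f' \o f) (g' \o g) t.
Proof.
elim/tens_ind: t => [|x y IHx IHy|v w]; first by rewrite !lfun0.
  by rewrite !lfunD IHx IHy.
by rewrite !tensmapE !comp_lfunE.
Qed.

Lemma tensmap_id V W (t : tens V W) : tensmap \1%VF \1%VF t = t.
Proof.
elim/tens_ind: t => [|x y IHx IHy|v w]; first by rewrite !lfun0.
  by rewrite !lfunD IHx IHy.
by rewrite !tensmapE !id_lfunE.
Qed.

Lemma hom_bij_comp U V W (g : 'Hom(V, W)) (f : 'Hom(U, V)) :
  bijective g -> bijective f -> bijective (g \o f)%VF.
Proof.
move=> bg bf; exists (f^-1 \o g^-1)%VF => x; rewrite !comp_lfunE ?hom_bijK //.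
by rewrite !hom_bijVK.
Qed.

Lemma tensmap_bij V V' W W' (f : 'Hom(V, V')) (g : 'Hom(W, W')) :
  bijective f -> bijective g -> bijective (tensmap f g).
Proof.
have inv U U' (h : 'Hom(U, U')) : bijective h ->
    (h^-1 \o h = \1)%VF /\ (h \o h^-1 = \1)%VF.
  by move=> bh; split; apply/lfunP=> x;
    rewrite comp_lfunE id_lfunE ?hom_bijK ?hom_bijVK.
move=> /inv[fK Kf] /inv[gK Kg].
by exists (tensmap f^-1 g^-1)%VF => t; rewrite tensmap_comp ?fK ?gK ?Kf ?Kg
  tensmap_id.
Qed.

Lemma tensmap_sq_bij V W (f : 'Hom(V, W)) :
  bijective f -> bijective (tensmap f f).
Proof. by move=> bf; apply: tensmap_bij. Qed.

Lemma tensmap_S23 V V' W W' (f : 'Hom(V, V')) (g : 'Hom(W, W')) x y :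
  tensmap (tensmap f g) (tensmap f g) (S23 V W (ptens x y)) =
  S23 V' W' (ptens (tensmap f f x) (tensmap g g y)).
Proof.
elim/tens_ind: x => [|x x' IHx IHx'|v v'].
- by rewrite !(ptens0l, lfun0).
- by rewrite !(ptensDl, lfunD) IHx IHx'.
elim/tens_ind: y => [|y y' IHy IHy'|w w'].
- by rewrite !(ptens0r, lfun0).
- by rewrite !(ptensDr, lfunD) IHy IHy'.
by rewrite !(tensmapE, S23E).
Qed.

(** A permutation of tensor factors hits all pure tensors. This lets a statement about any element
    of the square of V (x) W be checked on elements S23(x (x) y). *)
Lemma S23_surj V W t : exists t', t = S23 V W t'.
Proof.
elim/tens_ind: t => [|x y [x' ->] [y' ->]|x y].
- by exists 0; rewrite lfun0.
- by exists (x' + y'); rewrite lfunD.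
elim/tens_ind: x => [|x x' [t tE] [t' tE']|v w].
- by exists 0; rewrite ptens0l lfun0.
- by exists (t + t'); rewrite ptensDl lfunD tE tE'.
elim/tens_ind: y => [|y y' [t tE] [t' tE']|v' w'].
- by exists 0; rewrite ptens0r lfun0.
- by exists (t + t'); rewrite ptensDr lfunD tE tE'.
by exists (ptens (ptens v v') (ptens w w')); rewrite S23E.
Qed.

Definition dual_basis V (i : 'I_(\dim {:V})) : dual V :=
  linfun (coord (vbasis {:V}) i : V -> k^o).

Lemma dual_basisE V i (v : V) : dual_basis i v = coord (vbasis {:V}) i v.
Proof. by rewrite linfE // => a x y; rewrite linearP. Qed.

Lemma dual_basis_sum V (v : V) :
  v = \sum_(i < \dim {:V}) (dual_basis i v : k) *: (vbasis {:V})`_i.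
Proof.
rewrite {1}(coord_vbasis (memvf v)); apply: eq_bigr => i _.
by rewrite dual_basisE.
Qed.

Lemma dual_sum V (phi : dual V) :
  phi = \sum_(i < \dim {:V}) (phi (vbasis {:V})`_i : k) *: dual_basis i.
Proof.
apply/lfunP=> v; rewrite sum_lfunE {1}(dual_basis_sum v) linear_sum.
by apply: eq_bigr => i _; rewrite linearZ scale_lfunE /GRing.scale /= mulrC.
Qed.

(** If v differed from its projection to U, some coordinate of v - [projv U v] would be nonzero;
    that coordinate composed with 1 - [projv U] kills U. *)
Lemma dual_sep V (U : {vspace V}) v :
  (forall phi : dual V, (forall u, u \in U -> phi u = 0) -> phi v = 0) ->
  v \in U.
Proof.
move=> H; suff -> : v = projv U v by apply: memv_proj.
apply/eqP; rewrite -subr_eq0; apply/eqP.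
rewrite (dual_basis_sum (v - _)) big1 // => i _.
have := H (dual_basis i \o (\1 - projv U))%VF.
rewrite comp_lfunE add_lfunE opp_lfunE id_lfunE => ->; first by rewrite scale0r.
move=> u Uu; rewrite comp_lfunE add_lfunE opp_lfunE id_lfunE projv_id //.
by rewrite subrr linear0.
Qed.

Lemma dual_eq0 V (v : V) : (forall phi : dual V, phi v = 0) -> v = 0.
Proof.
by move=> H; apply/eqP; rewrite -memv0; apply: dual_sep => phi _; apply: H.
Qed.

Lemma dual_inj V (v w : V) : (forall phi : dual V, phi v = phi w) -> v = w.
Proof.
move=> H; apply/eqP; rewrite -subr_eq0; apply/eqP/dual_eq0 => phi.
by rewrite linearB /= H subrr.
Qed.

Definition ev V : 'Hom(V, dual (dual V)) :=
  linfun (fun v => linfun (fun phi : dual V => phi v) : dual (dual V)).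

Lemma evE V (v : V) phi : ev V v phi = phi v.
Proof.
have l (w : V) : linear (fun phi : dual V => phi w).
  by move=> a x y; rewrite add_lfunE scale_lfunE.
rewrite linfE ?linfE // => a x y; apply/lfunP=> f.
by rewrite add_lfunE scale_lfunE !linfE // linearP.
Qed.

Definition ev_inv V (F : dual (dual V)) : V :=
  \sum_(i < \dim {:V}) (F (dual_basis i) : k) *: (vbasis {:V})`_i.

Lemma ev_invE V (F : dual (dual V)) (phi : dual V) : phi (ev_inv F) = F phi.
Proof.
rewrite linear_sum {2}(dual_sum phi) linear_sum; apply: eq_bigr => i _.
by rewrite !linearZ; apply: mulrC.
Qed.

Lemma ev_bij V : bijective (ev V).
Proof.
exists (@ev_inv V) => [v|F]; last by apply/lfunP=> phi; rewrite evE ev_invE.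
by apply: dual_inj => phi; rewrite ev_invE evE.
Qed.

(** A bilinear form F on V is the sum of the e_i^* (x) F(e_i, -) over a basis; this is where finite
    dimension enters the theory of orthogonals. *)
Lemma tpair_surj V (F : dual (tens V V)) : exists y, tpair V y = F.
Proof.
pose Fi i : dual V := linfun (fun w => F (ptens (vbasis {:V})`_i w)).
have FiE i w : Fi i w = F (ptens (vbasis {:V})`_i w).
  by rewrite linfE //; apply: ptens_homr.
exists (\sum_i ptens (dual_basis i) (Fi i)); apply: tens_ext => v w.
rewrite linear_sum sum_lfunE.
under eq_bigr do rewrite tpairE FiE.
rewrite {2}(dual_basis_sum v) -[RHS](linfE (ptens_homl F w)) linear_sum /=.
by apply: eq_bigr => i _; rewrite linearZ /= linfE //; apply: ptens_homl.
Qed.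

Definition transp V W (f : 'Hom(V, W)) : 'Hom(dual W, dual V) :=
  linfun (fun phi : dual W => (phi \o f)%VF : dual V).

Lemma transpE V W (f : 'Hom(V, W)) (phi : dual W) v :
  transp f phi v = phi (f v).
Proof.
rewrite linfE ?comp_lfunE // => a x y; apply/lfunP=> u.
by rewrite !(comp_lfunE, add_lfunE, scale_lfunE).
Qed.

Lemma tpair_transp V W (f : 'Hom(V, W)) y t :
  tpair V (tensmap (transp f) (transp f) y) t = tpair W y (tensmap f f t).
Proof.
elim/tens_ind: y => [|x y IHx IHy|phi psi].
- by rewrite !lfun0 !zero_lfunE.
- by rewrite !lfunD !add_lfunE IHx IHy.
elim/tens_ind: t => [|x y IHx IHy|v w].
- by rewrite !lfun0.
- by rewrite !lfunD IHx IHy.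
by rewrite !tensmapE !tpairE !transpE.
Qed.

Lemma tpair_ev V y t :
  tpair (dual V) (tensmap (ev V) (ev V) t) y = tpair V y t.
Proof.
elim/tens_ind: t => [|x t IHx IHt|v w].
- by rewrite !lfun0 !zero_lfunE.
- by rewrite !lfunD add_lfunE IHx IHt.
elim/tens_ind: y => [|x y IHx IHy|phi psi].
- by rewrite !lfun0 !zero_lfunE.
- by rewrite !lfunD !add_lfunE IHx IHy.
by rewrite !tensmapE !tpairE !evE.
Qed.

(** The double orthogonal of R is R: subspaces are cut out by functionals, and every functional on V
    (x) V comes from the tensor square of the dual. *)
Lemma mem_orthK V (R : {vspace tens V V}) t :
  t \in R <-> (forall y, y \in orth R -> tpair V y t = 0).
Proof.
split=> [Rt y /mem_orth|H]; first exact.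
apply: dual_sep => F FR; have [y yE] := tpair_surj F.
by rewrite -yE; apply: H; apply/mem_orth => r Rr; rewrite yE FR.
Qed.

(* Write 1 (x) 1 = p (x) 1 + (1-p) (x) p' + (1-p) (x) (1-p') with p, p' the   *)
(* projections onto U, U': functionals composed with 1-p kill U.              *)
Lemma tensv_sep V W (U : {vspace V}) (U' : {vspace W}) (t : tens V W) :
  (forall (f : dual V) (g : dual W), (forall u, u \in U -> f u = 0) ->
    (forall u, u \in U' -> g u = 0) -> g (t f) = 0) ->
  t \in (tensv U fullv + tensv fullv U')%VS.
Proof.
move=> H; pose q := (\1 - projv U)%VF; pose q' := (\1 - projv U')%VF.
have qE v : q v = v - projv U v by rewrite add_lfunE opp_lfunE id_lfunE.
have qE' v : q' v = v - projv U' v by rewrite add_lfunE opp_lfunE id_lfunE.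
have T (f : dual V) (g : dual W) s :
    g (tensmap q q' s f) = (g \o q')%VF (s (f \o q)%VF).
  elim/tens_ind: s => [|x y IHx IHy|v w].
  - by rewrite lfun0 !zero_lfunE !lfun0.
  - by rewrite lfunD !add_lfunE !lfunD IHx IHy.
  by rewrite tensmapE !ptensE !linearZ /= !comp_lfunE.
have t0 : tensmap q q' t = 0.
  apply/lfunP=> f; rewrite zero_lfunE; apply: dual_eq0 => g; rewrite T.
  apply: H => u Uu; rewrite comp_lfunE ?qE ?qE' projv_id // subrr linear0 //.
suff M s : s - tensmap q q' s \in (tensv U fullv + tensv fullv U')%VS.
  by rewrite -[t]subr0 -t0.
elim/tens_ind: s => [|x y IHx IHy|v w].
- by rewrite lfun0 subrr mem0v.
- by rewrite lfunD opprD addrACA memvD.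
rewrite tensmapE.
have -> : ptens v w - ptens (q v) (q' w) =
    ptens (projv U v) w + ptens (q v) (projv U' w).
  apply/eqP; rewrite subr_eq -addrA -ptensDr qE' [projv _ w + _]addrC subrK.
  by rewrite -ptensDl qE addrC subrK.
by apply: memv_add; apply: mem_tensv; rewrite ?memvf ?memv_proj.
Qed.

End LinearAlgebra.

(** * Morphisms are determined in degree 1 *)

Section Lifting.
Variable k : fieldType.
Implicit Types A B : QA k.

Lemma tens_eval_gmor (A B : gralg k) (f : gmor A B) n t :
  f n (tens_eval A n t) = tens_eval B n (tpow_map (f 1%N) n t).
Proof.
elim: n t => [|n IH] t.
  by rewrite /= id_lfunE !linfE ?lfunZ ?gmor1 // => a x y;
    rewrite scalerDl scalerA.
elim/tpow_ind: t => [|x y IHx IHy|v t]; first by rewrite !lfun0.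
  by rewrite !lfunD IHx IHy.
by rewrite tpow_mapS !tens_evalS gmorM IH.
Qed.

(* A_1 generates A.                                                           *)
Lemma gmor_eq1 A B (f g : gmor A B) : (forall x, f 1%N x = g 1%N x) -> f = g.
Proof.
move=> fg; have E : f 1%N = g 1%N by apply/lfunP.
apply: gmor_eq => n x; have [t <-] := quad_generated (qa_quadratic A) x.
by rewrite !tens_eval_gmor E.
Qed.

Lemma tens_eval1 (A : gralg k) v : tens_eval A 1%N (ptens v (1 : k^o)) = v.
Proof. by rewrite tens_evalS (tens_eval0 (A := A)) scale1r gmul1r. Qed.

Lemma tens_eval2 (A : gralg k) t :
  tens_eval A 2 (tpow2 (A 1%N) t) = tlift (gmul (add1n 1)) t.
Proof.
elim/tens_ind: t => [|x y IHx IHy|v w]; first by rewrite !lfun0.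
  by rewrite !lfunD IHx IHy.
rewrite tpow2E (tens_evalS (A := A)) tens_eval1 tliftE //; exact: gmul_bilin.
Qed.

Lemma tens_evalM (A : gralg k) i j n (e : (i + j)%N = n) x y :
  tens_eval A n (tpow_mul e x y) =
  gmul e (tens_eval A i x) (tens_eval A j y).
Proof.
elim: i n e x => [|i IH] n e x.
  by case: _ / e; rewrite tpow_mul0 lfunZ (tens_eval0 (A := A)) gmulZl gmul1l.
case: n e => // n e; elim/tpow_ind: x => [|a b IHa IHb|v t].
- by rewrite tpow_mul0l !lfun0 gmul0.
- by rewrite tpow_mulDl !lfunD gmulDl IHa IHb.
rewrite (tpow_mul_consE (succn_inj e)) !(tens_evalS (A := A)) IH.
by rewrite (gmulA (add1n i) e (succn_inj e) (add1n n)).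
Qed.

Section Lift.
Variables (A B : QA k) (f : 'Hom(A 1%N, B 1%N)).
Hypothesis fR : forall r, r \in quad_rel A -> tensmap f f r \in quad_rel B.

(** The kernel of T(A_1) -> A is the ideal generated by R(A), so induction on membership in that
    ideal applies: [fR] treats the generators, and multiplicativity of evaluation the remaining
    rules. *)
Lemma lift_ker n t : tens_eval A n t = 0 -> tens_eval B n (tpow_map f n t) = 0.
Proof.
move=> /(quad_relations (qa_quadratic A)).
elim=> {n t} [s /memv_imgP[r Rr ->]|n|n x y _ Ix _ Iy|i j n e a x _ Ix
  |i j n e a x _ Ix].
- have -> : tpow_map f 2 (tpow2 (A 1%N) r) = tpow2 (B 1%N) (tensmap f f r).
    elim/tens_ind: r {Rr} => [|x y IHx IHy|v w]; first by rewrite !lfun0.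
      by rewrite !lfunD IHx IHy.
    by rewrite tensmapE !tpow2E !tpow_mapS /= id_lfunE.
  by rewrite tens_eval2; apply/eqP; rewrite -memv_ker; apply: fR.
- by rewrite !lfun0.
- by rewrite !lfunD Ix Iy addr0.
- by rewrite -[gmul _ _ _]/(tpow_mul e a x) tpow_mapM tens_evalM Ix gmulr0.
by rewrite -[gmul _ _ _]/(tpow_mul e a x) tpow_mapM tens_evalM Ix gmul0.
Qed.

(** The pseudo-inverse of [tens_eval] selects some preimage in the tensor algebra; by [lift_ker] the
    result does not depend on the choice. *)
Definition lift_map n : 'Hom(A n, B n) :=
  (tens_eval B n \o tpow_map f n \o (tens_eval A n)^-1)%VF.

Lemma lift_mapE n t :
  lift_map n (tens_eval A n t) = tens_eval B n (tpow_map f n t).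
Proof.
rewrite !comp_lfunE; apply/eqP; rewrite -subr_eq0 -!linearB /=.
apply/eqP/lift_ker; rewrite linearB /= limg_lfunVK ?subrr //.
by rewrite memv_img ?memvf.
Qed.

Lemma lift_map1 : lift_map 0%N (gone A) = gone B.
Proof.
have E (C : gralg k) : gone C = tens_eval C 0 (1 : k^o).
  by rewrite (tens_eval0 (A := C)) scale1r.
rewrite E lift_mapE (E B). by congr (tens_eval _ _ _); exact: id_lfunE.
Qed.

Lemma lift_mapM i j n (e : (i + j)%N = n) (a : A i) (b : A j) :
  lift_map n (gmul e a b) = gmul e (lift_map i a) (lift_map j b).
Proof.
have [s <-] := quad_generated (qa_quadratic A) a.
have [t <-] := quad_generated (qa_quadratic A) b.
by rewrite -tens_evalM !lift_mapE tpow_mapM tens_evalM.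
Qed.

Definition gmor_lift : gmor A B := Gmor lift_map1 lift_mapM.

Lemma gmor_liftE x : gmor_lift 1%N x = f x.
Proof.
rewrite -(tens_eval1 (A := A) x) [gmor_lift _ _]lift_mapE tpow_mapS.
by rewrite /= id_lfunE !tens_eval1.
Qed.

End Lift.

Lemma gmor_rel A B (f : gmor A B) r :
  r \in quad_rel A -> tensmap (f 1%N) (f 1%N) r \in quad_rel B.
Proof.
rewrite !memv_ker => /eqP r0; apply/eqP.
rewrite -(lfun0 (f 2)) -r0 -!tens_eval2 tens_eval_gmor.
congr (tens_eval _ _ _); elim/tens_ind: r {r0} => [|x y IHx IHy|v w].
- by rewrite !lfun0.
- by rewrite !lfunD IHx IHy.
by rewrite tensmapE !tpow2E !tpow_mapS /= id_lfunE.
Qed.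

End Lifting.

(** * Black and white products in parallel *)

Section Products.
Variable k : fieldType.
Local Notation QA := (QA k).

Lemma gmor_compE (A B C : QA) (g : gmor B C) (f : gmor A B) n x :
  gmor_comp g f n x = g n (f n x).
Proof. by rewrite /= comp_lfunE. Qed.

Lemma cmpE (A B C : QA) (g : mor B C) (f : mor A B) x :
  (cmp g f : gmor A C) 1%N x = g 1%N (f 1%N x).
Proof. by rewrite /= comp_lfunE. Qed.

Lemma idmE (A : QA) x : (idm A : gmor A A) 1%N x = x.
Proof. by rewrite /= id_lfunE. Qed.

Definition gmor_iso (A B : QA) (f : gmor A B) (g : gmor B A)
    (fK : cancel (f 1%N) (g 1%N)) (gK : cancel (g 1%N) (f 1%N)) :
    iso (A : QA_category k) B.
Proof.
by exists f g; apply: gmor_eq1 => x; rewrite cmpE idmE.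
Defined.

Lemma line_square (J : QA) (e : J 1%N) (eps : dual (J 1%N)) x :
  (forall v, (eps v : k) *: e = v) ->
  exists c, x = c *: ptens e e.
Proof.
move=> line; elim/tens_ind: x => [|_ _ [c ->] [d ->]|v w].
- by exists 0; rewrite scale0r.
- by exists (c + d); rewrite scalerDl.
exists ((eps v : k) * eps w).
by rewrite -{1}(line v) -{1}(line w) ptensZl ptensZr scalerA.
Qed.

(* R(P A B) is the span of S23(x (x) y) for all x, y with x \in R(A) op y \in *)
(* R(B): op = andb gives the black product, op = orb the white one.           *)
Record product (P : QA -> QA -> QA) (op : bool -> bool -> bool)
    (om : forall A B : QA, 'Hom(tens (A 1%N) (B 1%N), P A B 1%N)) : Prop :=
  Product {
  om_bij : forall A B, bijective (om A B);
  om_rel : forall (A B : QA) x y, op (x \in quad_rel A) (y \in quad_rel B) ->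
    tensmap (om A B) (om A B) (S23 _ _ (ptens x y)) \in quad_rel (P A B);
  om_rel_min : forall (A B : QA) (X : {vspace tens (P A B 1%N) (P A B 1%N)}),
    (forall x y, op (x \in quad_rel A) (y \in quad_rel B) ->
       tensmap (om A B) (om A B) (S23 _ _ (ptens x y)) \in X) ->
    (quad_rel (P A B) <= X)%VS;
  op_assoc : associative op;
  op_mono : forall p p' q q' : bool, (p -> p') -> (q -> q') -> op p q ->
    op p' q' }.

(** I_1 is a line with basis e and coordinate eps, so each element of its square is some c e (x) e.
    The last four fields say that the truth value of the membership of e (x) e in R(I) acts as a
    unit of [op], the scalar 0 being exempt because it is always a relation. *)
Record product_unit (op : bool -> bool -> bool) (I : QA) (e : I 1%N)
    (eps : dual (I 1%N)) : Prop := ProductUnit {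
  eps_e : eps e = (1 : k);
  eps_line : forall v, (eps v : k) *: e = v;
  unit_relr : forall c p, op (c *: ptens e e \in quad_rel I) p ->
    c = 0 \/ p;
  unit_rell : forall c p, op p (c *: ptens e e \in quad_rel I) ->
    c = 0 \/ p;
  rel_unitl : forall p : bool, p -> op (ptens e e \in quad_rel I) p;
  rel_unitr : forall p : bool, p -> op p (ptens e e \in quad_rel I) }.

Section Product.
Variables (P : QA -> QA -> QA) (op : bool -> bool -> bool).
Variable om : forall A B : QA, 'Hom(tens (A 1%N) (B 1%N), P A B 1%N).
Hypothesis HP : product op om.

Definition pr (A B : QA) (a : A 1%N) (b : B 1%N) : P A B 1%N :=
  om A B (ptens a b).

Lemma pr_bilin (A B : QA) : bilin (@pr A B).
Proof. by split=> [b|a]; [exact: ptens_homl | exact: ptens_homr]. Qed.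

Lemma pr_ind (A B : QA) (Q : P A B 1%N -> Prop) : Q 0 ->
  (forall x y, Q x -> Q y -> Q (x + y)) -> (forall a b, Q (pr a b)) ->
  forall u, Q u.
Proof.
move=> Q0 QD Qp u; rewrite -(hom_bijVK (om_bij HP A B) u).
move: ((om A B)^-1%VF u) => t; elim/tens_ind: t => [|x y IHx IHy|a b].
- by rewrite lfun0.
- by rewrite lfunD; apply: QD.
- exact: Qp.
Qed.

Lemma pr_hom_eq (A B : QA) (V : vectType k) (f g : 'Hom(P A B 1%N, V)) :
  (forall a b, f (pr a b) = g (pr a b)) -> forall u, f u = g u.
Proof.
by move=> fg; apply: pr_ind => [|x y|//]; rewrite ?lfun0 // !lfunD => -> ->.
Qed.

Lemma pr_eq A B (Z : QA) (f g : gmor (P A B) Z) :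
  (forall a b, f 1%N (pr a b) = g 1%N (pr a b)) -> f = g.
Proof. by move=> fg; apply/gmor_eq1/pr_hom_eq. Qed.

Lemma pr_hom_eq3 (A B C : QA) (V : vectType k)
    (f g : 'Hom(P (P A B) C 1%N, V)) :
  (forall a b c, f (pr (pr a b) c) = g (pr (pr a b) c)) -> forall u, f u = g u.
Proof.
move=> fg; apply: pr_hom_eq => u c.
have E (h : 'Hom(P (P A B) C 1%N, V)) u' :
    h (pr u' c) = linfun (fun u => h (pr u c)) u'.
  by rewrite linfE // => a x y; rewrite (pr_bilin _ _).1 linearP.
rewrite E [RHS]E; move: u; apply: pr_hom_eq => a b.
by rewrite !linfE // => s x y; rewrite (pr_bilin _ _).1 linearP.
Qed.

Lemma pr_eq3 (A B C : QA) (Z : QA) (f g : gmor (P (P A B) C) Z) :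
  (forall a b c, f 1%N (pr (pr a b) c) = g 1%N (pr (pr a b) c)) -> f = g.
Proof. by move=> fg; apply/gmor_eq1/pr_hom_eq3. Qed.

Lemma pr_eq4 A B C D (Z : QA) (f g : gmor (P (P (P A B) C) D) Z) :
  (forall a b c d, f 1%N (pr (pr (pr a b) c) d) = g 1%N (pr (pr (pr a b) c) d))
  -> f = g.
Proof.
move=> fg; apply/pr_eq => u d.
have E (h : gmor (P (P (P A B) C) D) Z) u' :
    h 1%N (pr u' d) = linfun (fun u => h 1%N (pr u d)) u'.
  by rewrite linfE // => a x y; rewrite (pr_bilin _ _).1 linearP.
rewrite E [RHS]E; move: u; apply: pr_hom_eq3 => a b c.
by rewrite !linfE // => s x y; rewrite (pr_bilin _ _).1 linearP.
Qed.

Lemma pr_lift (A B Z : QA) (h : A 1%N -> B 1%N -> Z 1%N) : bilin h ->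
  (forall x y, op (x \in quad_rel A) (y \in quad_rel B) ->
    tensmap (tlift h) (tlift h) (S23 _ _ (ptens x y)) \in quad_rel Z) ->
  {F : gmor (P A B) Z | forall a b, F 1%N (pr a b) = h a b}.
Proof.
move=> bh hR; pose f := (tlift h \o (om A B)^-1)%VF.
have fom t : f (om A B t) = tlift h t.
  by rewrite comp_lfunE hom_bijK //; exact: (om_bij HP).
have fR r : r \in quad_rel (P A B) -> tensmap f f r \in quad_rel Z.
  move: r; suff /subvP S :
      (quad_rel (P A B) <= tensmap f f @^-1: quad_rel Z)%VS.
    by move=> r /S; rewrite -memv_preim.
  apply: (om_rel_min HP) => x y xy; rewrite -memv_preim tensmap_comp.
  suff -> : (f \o om A B)%VF = tlift h by apply: hR.
  by apply/lfunP=> t; rewrite comp_lfunE fom.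
by exists (gmor_lift fR) => a b; rewrite gmor_liftE fom tliftE.
Qed.

(** A factor that is itself a product can be replaced by its spanning tensors. If z is a relation,
    this is [om_rel_min]. Otherwise [op false q] holds, so by monotonicity the hypothesis covers all
    x and y, and such tensors span the whole square. *)
Lemma rel_indl (A B : QA) (q : bool)
    (X : {vspace tens (P A B 1%N) (P A B 1%N)}) z :
  (forall x y, op (op (x \in quad_rel A) (y \in quad_rel B)) q ->
     tensmap (om A B) (om A B) (S23 _ _ (ptens x y)) \in X) ->
  op (z \in quad_rel (P A B)) q -> z \in X.
Proof.
move=> HX; case: (boolP (z \in _)) => [zR oq|_ oq].
  have /subvP : (quad_rel (P A B) <= X)%VS; last exact.
  apply: (om_rel_min HP) => x y xy; apply: HX.
  exact: (op_mono HP _ id oq).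
have [t _ tK] := tensmap_sq_bij (om_bij HP A B).
rewrite -(tK z); have [s ->] := S23_surj (t z).
elim/tens_ind: s => [|s s' IHs IHs'|x y]; rewrite ?lfun0 ?mem0v ?lfunD //.
  exact: memvD.
by apply: HX; apply: (op_mono HP _ id oq).
Qed.

Lemma rel_indr (A B : QA) (q : bool)
    (X : {vspace tens (P A B 1%N) (P A B 1%N)}) z :
  (forall x y, op q (op (x \in quad_rel A) (y \in quad_rel B)) ->
     tensmap (om A B) (om A B) (S23 _ _ (ptens x y)) \in X) ->
  op q (z \in quad_rel (P A B)) -> z \in X.
Proof.
move=> HX; case: (boolP (z \in _)) => [zR oq|_ oq].
  have /subvP : (quad_rel (P A B) <= X)%VS; last exact.
  apply: (om_rel_min HP) => x y xy; apply: HX.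
  exact: (op_mono HP id _ oq).
have [t _ tK] := tensmap_sq_bij (om_bij HP A B).
rewrite -(tK z); have [s ->] := S23_surj (t z).
elim/tens_ind: s => [|s s' IHs IHs'|x y]; rewrite ?lfun0 ?mem0v ?lfunD //.
  exact: memvD.
by apply: HX; apply: (op_mono HP id _ oq).
Qed.

Lemma pr_map (A A' B B' : QA) (f : gmor A A') (g : gmor B B') :
  {F : gmor (P A B) (P A' B') |
    forall a b, F 1%N (pr a b) = pr (f 1%N a) (g 1%N b)}.
Proof.
have bh : bilin (fun a b => pr (f 1%N a) (g 1%N b)).
  by split=> [b|a] s x y; rewrite lfun_lin; [apply: (pr_bilin _ _).1 |
    apply: (pr_bilin _ _).2].
apply: (pr_lift bh) => x y xy.
have -> : tlift (fun a b => pr (f 1%N a) (g 1%N b)) =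
    (om A' B' \o tensmap (f 1%N) (g 1%N))%VF.
  by apply: tens_ext => a b; rewrite tliftE // comp_lfunE tensmapE.
rewrite -tensmap_comp tensmap_S23; apply: (om_rel HP).
by apply: (op_mono HP _ _ xy); apply: gmor_rel.
Qed.

Lemma assoc_hl_bilin (A B C : QA) : bilin (fun (u : P A B 1%N) (c : C 1%N) =>
  tlift (fun (a : A 1%N) (b : B 1%N) => pr a (pr b c)) ((om A B)^-1%VF u)).
Proof.
have b0 (c : C 1%N) : bilin (fun (a : A 1%N) (b : B 1%N) => pr a (pr b c)).
  split=> [b|a] s x y; first exact: (pr_bilin _ _).1.
  by rewrite (pr_bilin _ _).1 (pr_bilin _ _).2.
split=> [c|u] s x y; first by rewrite !linearP.
by apply: tlift_lin => // a b; rewrite !(pr_bilin _ _).2.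
Qed.

Lemma assoc_hr_bilin (A B C : QA) : bilin (fun (a : A 1%N) (u : P B C 1%N) =>
  tlift (fun (b : B 1%N) (c : C 1%N) => pr (pr a b) c) ((om B C)^-1%VF u)).
Proof.
have b0 (a : A 1%N) : bilin (fun (b : B 1%N) (c : C 1%N) => pr (pr a b) c).
  split=> [c|b] s x y; last exact: (pr_bilin _ _).2.
  by rewrite (pr_bilin _ _).2 (pr_bilin _ _).1.
split=> [u|a] s x y; last by rewrite !linearP.
by apply: tlift_lin => // b c; rewrite !(pr_bilin _ _).1.
Qed.

(** The identity [key] matches the rearrangements of x (x) y (x) z for the two bracketings. After
    [rel_indl] opens the inner product, the condition for being a relation is rebracketed by
    [op_assoc]. *)
Lemma pr_assoc (A B C : QA) : {F : gmor (P (P A B) C) (P A (P B C)) |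
  forall a b c, F 1%N (pr (pr a b) c) = pr a (pr b c)}.
Proof.
have bh := assoc_hl_bilin A B C; set h := (fun _ _ => _) in bh.
have b0 (c : C 1%N) : bilin (fun (a : A 1%N) (b : B 1%N) => pr a (pr b c)).
  split=> [b|a] s x y; first exact: (pr_bilin _ _).1.
  by rewrite (pr_bilin _ _).1 (pr_bilin _ _).2.
have hE a b c : tlift h (ptens (pr a b) c) = pr a (pr b c).
  by rewrite tliftE // /h hom_bijK ?tliftE //; exact: (om_bij HP).
have [|F FE] := @pr_lift _ _ (P A (P B C)) _ bh; last first.
  by exists F => a b c; rewrite FE /h hom_bijK ?tliftE //; exact: (om_bij HP).
have key x y z : tensmap (tlift h) (tlift h) (S23 _ _
      (ptens (tensmap (om A B) (om A B) (S23 _ _ (ptens x y))) z)) =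
    tensmap (om A (P B C)) (om A (P B C)) (S23 _ _
      (ptens x (tensmap (om B C) (om B C) (S23 _ _ (ptens y z))))).
  elim/tens_ind: x => [|x x' IHx IHx'|a a'].
  - by rewrite !(ptens0l, lfun0).
  - by rewrite !(ptensDl, lfunD) IHx IHx'.
  elim/tens_ind: y => [|y y' IHy IHy'|b b'].
  - by rewrite !(ptens0l, ptens0r, lfun0).
  - by rewrite !(ptensDl, ptensDr, lfunD) IHy IHy'.
  elim/tens_ind: z => [|z z' IHz IHz'|c c'].
  - by rewrite !(ptens0l, ptens0r, lfun0).
  - by rewrite !(ptensDl, ptensDr, lfunD) IHz IHz'.
  by rewrite !(tensmapE, S23E) !hE.
move=> z y zy.
pose X := (linfun (fun z => tensmap (tlift h) (tlift h) (S23 _ _ (ptens z y)))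
  @^-1: quad_rel (P A (P B C)))%VS.
have lX : linear (fun z : tens (P A B 1%N) (P A B 1%N) =>
    tensmap (tlift h) (tlift h) (S23 _ _ (ptens z y))).
  by move=> s u v; rewrite ptens_linl !lfun_lin.
suff : z \in X by rewrite -memv_preim linfE.
apply: (rel_indl _ zy) => x1 x2 xy; rewrite -memv_preim linfE // key.
apply: (om_rel HP); rewrite -(op_assoc HP) in xy.
by apply: (op_mono HP id _ xy); exact: (om_rel HP).
Qed.

Lemma pr_assoc_inv (A B C : QA) : {F : gmor (P A (P B C)) (P (P A B) C) |
  forall a b c, F 1%N (pr a (pr b c)) = pr (pr a b) c}.
Proof.
have bh := assoc_hr_bilin A B C; set h := (fun _ _ => _) in bh.
have b0 (a : A 1%N) : bilin (fun (b : B 1%N) (c : C 1%N) => pr (pr a b) c).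
  split=> [c|b] s x y; last exact: (pr_bilin _ _).2.
  by rewrite (pr_bilin _ _).2 (pr_bilin _ _).1.
have hE a b c : tlift h (ptens a (pr b c)) = pr (pr a b) c.
  by rewrite tliftE // /h hom_bijK ?tliftE //; exact: (om_bij HP).
have [|F FE] := @pr_lift _ _ (P (P A B) C) _ bh; last first.
  by exists F => a b c; rewrite FE /h hom_bijK ?tliftE //; exact: (om_bij HP).
have key x y z : tensmap (tlift h) (tlift h) (S23 _ _
      (ptens x (tensmap (om B C) (om B C) (S23 _ _ (ptens y z))))) =
    tensmap (om (P A B) C) (om (P A B) C) (S23 _ _
      (ptens (tensmap (om A B) (om A B) (S23 _ _ (ptens x y))) z)).
  elim/tens_ind: x => [|x x' IHx IHx'|a a'].
  - by rewrite !(ptens0l, lfun0).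
  - by rewrite !(ptensDl, lfunD) IHx IHx'.
  elim/tens_ind: y => [|y y' IHy IHy'|b b'].
  - by rewrite !(ptens0l, ptens0r, lfun0).
  - by rewrite !(ptensDl, ptensDr, lfunD) IHy IHy'.
  elim/tens_ind: z => [|z z' IHz IHz'|c c'].
  - by rewrite !(ptens0l, ptens0r, lfun0).
  - by rewrite !(ptensDl, ptensDr, lfunD) IHz IHz'.
  by rewrite !(tensmapE, S23E) !hE.
move=> y z yz.
pose X := (linfun (fun z => tensmap (tlift h) (tlift h) (S23 _ _ (ptens y z)))
  @^-1: quad_rel (P (P A B) C))%VS.
have lX : linear (fun z : tens (P B C 1%N) (P B C 1%N) =>
    tensmap (tlift h) (tlift h) (S23 _ _ (ptens y z))).
  by move=> s u v; rewrite ptens_linr !lfun_lin.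
suff : z \in X by rewrite -memv_preim linfE.
apply: (rel_indr _ yz) => x1 x2 xy; rewrite -memv_preim linfE // key.
apply: (om_rel HP); rewrite (op_assoc HP) in xy.
by apply: (op_mono HP _ id xy); exact: (om_rel HP).
Qed.

Section Unit.
Variables (I : QA) (e : I 1%N) (eps : dual (I 1%N)).
Hypothesis HI : product_unit op e eps.

(** An element of the square of I_1 is c e (x) e, and the contraction v (x) x |-> eps(v) x sends its
    rearrangement with y to c y; this lies in R(X) since c = 0 or y is a relation. *)
Lemma pr_lunit (X : QA) :
  {F : gmor (P I X) X | forall x, F 1%N (pr e x) = x}.
Proof.
have bh : bilin (fun (v : I 1%N) (x : X 1%N) => (eps v : k) *: x).
  split=> [x|v] s u w; first by rewrite lfun_lin scalerDl scalerA.
  by rewrite scalerDr !scalerA mulrC.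
have [|F FE] := pr_lift bh; last first.
  by exists F => x; rewrite FE (eps_e HI) scale1r.
move=> z y; have [c ->] := line_square z (eps_line HI) => /(unit_relr HI) H.
have -> : tensmap (tlift (fun v x => (eps v : k) *: x))
    (tlift (fun v x => (eps v : k) *: x)) (S23 _ _ (ptens (c *: ptens e e) y))
    = c *: y.
  rewrite ptensZl !lfunZ; congr (_ *: _).
  elim/tens_ind: y {H} => [|y y' IHy IHy'|x x'].
  - by rewrite !(ptens0r, lfun0).
  - by rewrite !(ptensDr, lfunD) IHy IHy'.
  by rewrite S23E tensmapE !tliftE // (eps_e HI) !scale1r.
by case: H => [->|/memvZ//]; rewrite scale0r mem0v.
Qed.

Lemma pr_runit (X : QA) :
  {F : gmor (P X I) X | forall x, F 1%N (pr x e) = x}.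
Proof.
have bh : bilin (fun (x : X 1%N) (v : I 1%N) => (eps v : k) *: x).
  split=> [v|x] s u w; last by rewrite lfun_lin scalerDl scalerA.
  by rewrite scalerDr !scalerA mulrC.
have [|F FE] := pr_lift bh; last first.
  by exists F => x; rewrite FE (eps_e HI) scale1r.
move=> y z; have [c ->] := line_square z (eps_line HI) => /(unit_rell HI) H.
have -> : tensmap (tlift (fun x v => (eps v : k) *: x))
    (tlift (fun x v => (eps v : k) *: x)) (S23 _ _ (ptens y (c *: ptens e e)))
    = c *: y.
  rewrite ptensZr !lfunZ; congr (_ *: _).
  elim/tens_ind: y {H} => [|y y' IHy IHy'|x x'].
  - by rewrite !(ptens0l, lfun0).
  - by rewrite !(ptensDl, lfunD) IHy IHy'.
  by rewrite S23E tensmapE !tliftE // (eps_e HI) !scale1r.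
by case: H => [->|/memvZ//]; rewrite scale0r mem0v.
Qed.

Lemma pr_lunit_inv (X : QA) :
  {F : gmor X (P I X) | forall x, F 1%N x = pr e x}.
Proof.
have fE (x : X 1%N) : linfun (pr e) x = pr e x.
  by rewrite linfE //; apply: (pr_bilin I X).2.
have fR r : r \in quad_rel X ->
    tensmap (linfun (pr e)) (linfun (pr e)) r \in quad_rel (P I X).
  have <- : tensmap (om I X) (om I X) (S23 _ _ (ptens (ptens e e) r)) =
      tensmap (linfun (pr e)) (linfun (pr e)) r.
    elim/tens_ind: r => [|y y' IHy IHy'|x x'].
    - by rewrite !(ptens0r, lfun0).
    - by rewrite !(ptensDr, lfunD) IHy IHy'.
    by rewrite S23E !tensmapE !fE.
  by move=> rR; apply/(om_rel HP)/(rel_unitl HI).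
by exists (gmor_lift fR) => x; rewrite gmor_liftE fE.
Qed.

Lemma pr_runit_inv (X : QA) :
  {F : gmor X (P X I) | forall x, F 1%N x = pr x e}.
Proof.
have fE (x : X 1%N) : linfun ((@pr X I)^~ e) x = pr x e.
  by rewrite linfE //; apply: (pr_bilin X I).1.
have fR r : r \in quad_rel X -> tensmap (linfun ((@pr X I)^~ e))
    (linfun ((@pr X I)^~ e)) r \in quad_rel (P X I).
  have <- : tensmap (om X I) (om X I) (S23 _ _ (ptens r (ptens e e))) =
      tensmap (linfun ((@pr X I)^~ e)) (linfun ((@pr X I)^~ e)) r.
    elim/tens_ind: r => [|y y' IHy IHy'|x x'].
    - by rewrite !(ptens0l, lfun0).
    - by rewrite !(ptensDl, lfunD) IHy IHy'.
    by rewrite S23E !tensmapE !fE.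
  by move=> rR; apply/(om_rel HP)/(rel_unitr HI).
by exists (gmor_lift fR) => x; rewrite gmor_liftE fE.
Qed.

(** As I_1 is spanned by e, each element is a single [pr e x], with no sum needed. *)
Lemma pr_e_ind (X : QA) (Q : P I X 1%N -> Prop) :
  (forall x, Q (pr e x)) -> forall u, Q u.
Proof.
move=> Qe u; suff [x ->] : exists x, u = pr e x by [].
elim/pr_ind: u => [|_ _ [x ->] [y ->]|v x].
- by exists 0; rewrite /pr ptens0r lfun0.
- by exists (x + y); rewrite /pr ptensDr lfunD.
by exists ((eps v : k) *: x); rewrite -{1}(eps_line HI v) /pr ptensZl ptensZr.
Qed.

Lemma pr_ind_e (X : QA) (Q : P X I 1%N -> Prop) :
  (forall x, Q (pr x e)) -> forall u, Q u.
Proof.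
move=> Qe u; suff [x ->] : exists x, u = pr x e by [].
elim/pr_ind: u => [|_ _ [x ->] [y ->]|x v].
- by exists 0; rewrite /pr ptens0l lfun0.
- by exists (x + y); rewrite /pr ptensDl lfunD.
by exists ((eps v : k) *: x); rewrite -{1}(eps_line HI v) /pr ptensZl ptensZr.
Qed.

Definition pr_tmap (A A' B B' : QA) (f : gmor A A') (g : gmor B B') :=
  sval (pr_map f g).

Lemma pr_tmapE (A A' B B' : QA) (f : gmor A A') (g : gmor B B') a b :
  pr_tmap f g 1%N (pr a b) = pr (f 1%N a) (g 1%N b).
Proof. exact: (svalP (pr_map f g)). Qed.

Definition pr_assoc_iso (A B C : QA) : iso (P (P A B) C) (P A (P B C)).
Proof.
apply: (@gmor_iso _ _ (sval (pr_assoc A B C)) (sval (pr_assoc_inv A B C))).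
- move=> u; rewrite -[RHS]idmE -cmpE; move: u; apply: pr_hom_eq3 => a b c.
  by rewrite cmpE idmE (svalP (pr_assoc A B C)) (svalP (pr_assoc_inv A B C)).
move=> u; rewrite -[RHS]idmE -cmpE; move: u; apply: pr_hom_eq => a u.
elim/pr_ind: u => [|x y IHx IHy|b c].
- by rewrite /pr ptens0r !lfun0.
- by rewrite /pr ptensDr !lfunD IHx IHy.
by rewrite cmpE idmE (svalP (pr_assoc_inv A B C)) (svalP (pr_assoc A B C)).
Defined.

Lemma pr_assoc_isoE (A B C : QA) a b c :
  fwd (pr_assoc_iso A B C) 1%N (pr (pr a b) c) = pr a (pr b c).
Proof. exact: (svalP (pr_assoc A B C)). Qed.

Definition pr_lunit_iso (X : QA) : iso (P I X) X.
Proof.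
apply: (@gmor_iso _ _ (sval (pr_lunit X)) (sval (pr_lunit_inv X))).
- elim/pr_e_ind => x.
  by rewrite (svalP (pr_lunit X)) (svalP (pr_lunit_inv X)).
by move=> x; rewrite (svalP (pr_lunit_inv X)) (svalP (pr_lunit X)).
Defined.

Lemma pr_lunit_isoE (X : QA) x : fwd (pr_lunit_iso X) 1%N (pr e x) = x.
Proof. exact: (svalP (pr_lunit X)). Qed.

Definition pr_runit_iso (X : QA) : iso (P X I) X.
Proof.
apply: (@gmor_iso _ _ (sval (pr_runit X)) (sval (pr_runit_inv X))).
- elim/pr_ind_e => x.
  by rewrite (svalP (pr_runit X)) (svalP (pr_runit_inv X)).
by move=> x; rewrite (svalP (pr_runit_inv X)) (svalP (pr_runit X)).
Defined.

Lemma pr_runit_isoE (X : QA) x : fwd (pr_runit_iso X) 1%N (pr x e) = x.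
Proof. exact: (svalP (pr_runit X)). Qed.

Definition prE :=
  (cmpE, idmE, pr_tmapE, pr_assoc_isoE, pr_lunit_isoE, pr_runit_isoE).

(** Each coherence law equates two morphisms with the same effect on products of degree 1 elements,
    so the formulas for the constraints decide it. These formulas are exported with the structure,
    which is later used only through them. *)
Lemma product_monoidal : {M : @monoidal (QA_category k) P I |
  [/\ forall (A A' B B' : QA) (f : gmor A A') (g : gmor B B') a b,
        tmap M f g 1%N (pr a b) = pr (f 1%N a) (g 1%N b),
      forall (A B C : QA) (a : A 1%N) (b : B 1%N) (c : C 1%N),
        fwd (assoc M A B C) 1%N (pr (pr a b) c) = pr a (pr b c),
      forall (A : QA) (a : A 1%N), fwd (lunit M A) 1%N (pr e a) = a
    & forall (A : QA) (a : A 1%N), fwd (runit M A) 1%N (pr a e) = a]}.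
Proof.
unshelve eexists.
  apply: (@Monoidal (QA_category k) P I pr_tmap _ _ pr_assoc_iso _
    pr_lunit_iso _ pr_runit_iso).
  - by move=> X Y; apply: pr_eq => a b; rewrite !prE.
  - by move=> X X' X'' Y Y' Y'' f' f g' g; apply: pr_eq => a b; rewrite !prE.
  - by move=> X X' Y Y' Z Z' f g h; apply: pr_eq3 => a b c; rewrite !prE.
  - by move=> X X' f; apply: gmor_eq1; elim/pr_e_ind => x; rewrite !prE.
  - by move=> X X' f; apply: gmor_eq1; elim/pr_ind_e => x; rewrite !prE.
  - by move=> X0 X Y Z; apply: pr_eq4 => a b c d; rewrite !prE.
  by move=> X Y; apply: pr_eq => u y; elim/pr_ind_e: u => x; rewrite !prE.
by split=> *; rewrite /= ?prE.
Qed.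

End Unit.
End Product.
End Products.

(** * The black product *)

Section Presentations.
Variable k : fieldType.
Local Notation QA := (QA k).

Section Pres.
Variables (V : vectType k) (R : {vspace tens V V}).

Lemma pres_ind (Q : pres R 1%N -> Prop) :
  (forall v, Q (pres_gen R v)) -> forall u, Q u.
Proof. by move=> Qg u; rewrite -(hom_bijVK (pres_gen_bij R) u). Qed.

Lemma pres_gmor_eq (Z : QA) (f g : gmor (pres R) Z) :
  (forall v, f 1%N (pres_gen R v) = g 1%N (pres_gen R v)) -> f = g.
Proof. by move=> fg; apply: gmor_eq1; apply: pres_ind. Qed.

Lemma pres_relE r :
  (tensmap (pres_gen R) (pres_gen R) r \in quad_rel (pres R)) = (r \in R).
Proof.
rewrite pres_rel; apply/idP/idP => [/memv_imgP[s Rs E]|]; last exact: memv_img.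
by rewrite (bij_inj (tensmap_sq_bij (pres_gen_bij R)) E).
Qed.

Lemma pres_lift (Z : QA) (h : 'Hom(V, Z 1%N)) :
  (forall r, r \in R -> tensmap h h r \in quad_rel Z) ->
  {F : gmor (pres R) Z | forall v, F 1%N (pres_gen R v) = h v}.
Proof.
move=> hR; pose f := (h \o (pres_gen R)^-1)%VF.
have fg : (f \o pres_gen R)%VF = h.
  by apply/lfunP=> v; rewrite !comp_lfunE hom_bijK //; apply: pres_gen_bij.
have fR r : r \in quad_rel (pres R) -> tensmap f f r \in quad_rel Z.
  rewrite -[X in _ -> tensmap f f X \in _](hom_bijVK (tensmap_sq_bij
    (pres_gen_bij R)) r) -{1}(hom_bijVK (tensmap_sq_bij (pres_gen_bij R)) r).
  by rewrite pres_relE tensmap_comp fg; apply: hR.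
by exists (gmor_lift fR) => v; rewrite gmor_liftE -fg comp_lfunE.
Qed.

End Pres.

Definition bul_gen (A B : QA) : 'Hom(tens (A 1%N) (B 1%N), bullet A B 1%N) :=
  pres_gen (bullet_rel A B).

Lemma bul_gen_bij (A B : QA) : bijective (bul_gen A B).
Proof. exact: pres_gen_bij. Qed.

Lemma bullet_product : product andb bul_gen.
Proof.
split=> [A B|A B x y /andP[Ax By]|A B X HX|p q r|
  p p' q q' pp' qq' /andP[Pp Pq]].
- exact: pres_gen_bij.
- by rewrite pres_relE; apply/memv_img/mem_tensv.
- rewrite pres_rel /bullet_rel -limg_comp; apply/subvP=> _ /memv_imgP[x xT ->].
  set f := (_ \o _)%VF.
  suff : (tensv (quad_rel A) (quad_rel B) <= f @^-1: X)%VS.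
    by move=> /subvP/(_ _ xT); rewrite -memv_preim.
  apply/tensv_subP => x1 x2 Ax By; rewrite -memv_preim comp_lfunE.
  by apply: HX; rewrite Ax By.
- exact: andbA.
by rewrite pp' // qq'.
Qed.

(** Only the presentation of P A B is assumed, because the white product is defined through an
    arbitrary quasi-inverse and not as a given quotient of a tensor algebra. *)
Lemma white_product (P : QA -> QA -> QA)
    (om : forall A B : QA, 'Hom(tens (A 1%N) (B 1%N), P A B 1%N)) :
  (forall A B, presents (white_rel A B) (om A B)) -> product orb om.
Proof.
move=> pom; split=> [A B|A B x y xy|A B X HX|p q r|p p' q q' pp' qq' /orP[]].
- exact: (pom A B).1.
- rewrite -(pom A B).2; do 2!apply: memv_img.
  case/orP: xy => [Ax|By].
    by apply: (subvP (addvSl _ _)); apply: mem_tensv; rewrite ?memvf.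
  by apply: (subvP (addvSr _ _)); apply: mem_tensv; rewrite ?memvf.
- rewrite -(pom A B).2 /white_rel -limg_comp.
  apply/subvP=> _ /memv_imgP[x xT ->]; set f := (_ \o _)%VF.
  suff : (tensv (quad_rel A) fullv + tensv fullv (quad_rel B)
          <= f @^-1: X)%VS.
    by move=> /subvP/(_ _ xT); rewrite -memv_preim.
  rewrite subv_add; apply/andP; split; apply/tensv_subP => x1 x2 Ax By;
    rewrite -memv_preim comp_lfunE; apply: HX.
    by rewrite Ax.
  by rewrite By orbT.
- exact: orbA.
- by move=> /pp' ->.
- by move=> /qq' ->; rewrite orbT.
Qed.

(** * The two unit objects and the black monoidal structure *)

Definition tau_coef : dual (dual_numbers k 1%N) :=
  linfun (@dual_coef k 1 : dual_numbers k 1%N -> k^o).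

Lemma tau_coefE v : tau_coef v = dual_coef (v : dual_gr k 1).
Proof. by rewrite linfE // => a x y; apply: dual_coef_lin. Qed.

Lemma tau_coef_tau : tau_coef (tau k) = (1 : k).
Proof. by rewrite tau_coefE dual_eltK. Qed.

Lemma tau_line v : (tau_coef v : k) *: tau k = v.
Proof.
rewrite tau_coefE -[RHS](dual_coefK (v : dual_gr k 1)).
by apply/rowP=> s; rewrite !mxE mulr1.
Qed.

Lemma dual_numbers_rel r : r \in quad_rel (dual_numbers k).
Proof. by rewrite memv_ker; apply/eqP/rowP=> -[]. Qed.

Definition t_coef : dual (poly_ring k 1%N) := \1%VF.

Lemma t_coef_t : t_coef (poly_t k) = (1 : k).
Proof. by rewrite id_lfunE. Qed.

Lemma t_line v : (t_coef v : k) *: poly_t k = v.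
Proof. by rewrite id_lfunE; apply: mulr1. Qed.

Lemma poly_ring_rel c :
  c *: ptens (poly_t k) (poly_t k) \in quad_rel (poly_ring k) -> c = 0.
Proof.
rewrite memv_ker lfunZ tliftE; last exact: gmul_bilin.
by move=> /eqP E; rewrite -[c]mulr1 -(mulr1 1); apply: E.
Qed.

Lemma dual_numbers_unit : product_unit andb (tau k) tau_coef.
Proof.
split=> [|v|c p /andP[_]|c p /andP[]|p|p]; rewrite ?dual_numbers_rel ?andbT //.
- exact: tau_coef_tau.
- exact: tau_line.
- by right.
- by right.
Qed.

Lemma poly_ring_unit : product_unit orb (poly_t k) t_coef.
Proof.
split=> [|v|c p /orP[/poly_ring_rel|]|c p /orP[|/poly_ring_rel]|p ->|p ->].
- exact: t_coef_t.
- exact: t_line.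
- by left.
- by right.
- by right.
- by left.
- exact: orbT.
- by [].
Qed.

Lemma bul_genE (A B : QA) (a : A 1%N) (b : B 1%N) :
  bul_gen A B (ptens a b) = bul a b.
Proof. by []. Qed.

Lemma bulE (A B : QA) (a : A 1%N) (b : B 1%N) :
  bul a b = pr bul_gen a b.
Proof. by []. Qed.

Definition bullet_monoidal :
    @monoidal (QA_category k) (@bullet k) (dual_numbers k) :=
  sval (product_monoidal bullet_product dual_numbers_unit).

Local Notation M := bullet_monoidal.

Lemma bullet_monoidalP :
  [/\ forall (A A' B B' : QA) (f : gmor A A') (g : gmor B B') a b,
        tmap M f g 1%N (bul a b) = bul (f 1%N a) (g 1%N b),
      forall (A B C : QA) (a : A 1%N) (b : B 1%N) (c : C 1%N),
        fwd (assoc M A B C) 1%N (bul (bul a b) c) = bul a (bul b c),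
      forall (A : QA) (a : A 1%N), fwd (lunit M A) 1%N (bul (tau k) a) = a
    & forall (A : QA) (a : A 1%N), fwd (runit M A) 1%N (bul a (tau k)) = a].
Proof. exact: (svalP (product_monoidal bullet_product dual_numbers_unit)). Qed.

Lemma bul_tmapE (A A' B B' : QA) (f : gmor A A') (g : gmor B B') a b :
  tmap M f g 1%N (bul a b) = bul (f 1%N a) (g 1%N b).
Proof. by case: bullet_monoidalP => H _ _ _; apply: H. Qed.

Lemma bul_assocE (A B C : QA) (a : A 1%N) (b : B 1%N) (c : C 1%N) :
  fwd (assoc M A B C) 1%N (bul (bul a b) c) = bul a (bul b c).
Proof. by case: bullet_monoidalP => _ H _ _; apply: H. Qed.

Lemma bul_lunitE (A : QA) (a : A 1%N) :
  fwd (lunit M A) 1%N (bul (tau k) a) = a.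
Proof. by case: bullet_monoidalP => _ _ H _; apply: H. Qed.

Lemma bul_runitE (A : QA) (a : A 1%N) :
  fwd (runit M A) 1%N (bul a (tau k)) = a.
Proof. by case: bullet_monoidalP => _ _ _ H; apply: H. Qed.

Lemma bul_ind (A B : QA) (Q : bullet A B 1%N -> Prop) : Q 0 ->
  (forall x y, Q x -> Q y -> Q (x + y)) -> (forall a b, Q (bul a b)) ->
  forall u, Q u.
Proof. exact: (pr_ind bullet_product). Qed.

Lemma bul_hom_eq (A B : QA) (V : vectType k) (f g : 'Hom(bullet A B 1%N, V)) :
  (forall a b, f (bul a b) = g (bul a b)) -> forall u, f u = g u.
Proof. exact: (pr_hom_eq bullet_product). Qed.

Lemma bul_hom_eq3 (A B C : QA) (V : vectType k)
    (f g : 'Hom(bullet (bullet A B) C 1%N, V)) :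
  (forall a b c, f (bul (bul a b) c) = g (bul (bul a b) c)) ->
  forall u, f u = g u.
Proof. exact: (pr_hom_eq3 bullet_product). Qed.

Lemma bul_eq (A B Z : QA) (f g : gmor (bullet A B) Z) :
  (forall a b, f 1%N (bul a b) = g 1%N (bul a b)) -> f = g.
Proof. exact: (pr_eq bullet_product). Qed.

Lemma line_lift (I J : QA) (e : I 1%N) (eps : dual (I 1%N)) (e' : J 1%N) :
  eps e = (1 : k) -> (forall v, (eps v : k) *: e = v) ->
  (forall c, c *: ptens e e \in quad_rel I ->
    c *: ptens e' e' \in quad_rel J) ->
  {F : gmor I J | F 1%N e = e'}.
Proof.
move=> eps1 line R; pose f := linfun (fun v => (eps v : k) *: e').
have fE v : f v = (eps v : k) *: e'.
  by rewrite linfE // => a x y; rewrite lfun_lin scalerDl scalerA.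
have fR r : r \in quad_rel I -> tensmap f f r \in quad_rel J.
  have [c -> /R] := line_square r line.
  by rewrite lfunZ tensmapE fE eps1 scale1r.
by exists (gmor_lift fR); rewrite gmor_liftE fE eps1 scale1r.
Qed.

(** A quadratic algebra with one generator is determined by whether the square of the generator is a
    relation; this identifies the duals of the dual numbers and of k[t]. *)
Definition line_iso (I J : QA) (e : I 1%N) (eps : dual (I 1%N)) (e' : J 1%N)
    (eps' : dual (J 1%N)) :
  eps e = (1 : k) -> (forall v, (eps v : k) *: e = v) ->
  eps' e' = (1 : k) -> (forall v, (eps' v : k) *: e' = v) ->
  (forall c, (c *: ptens e e \in quad_rel I) =
    (c *: ptens e' e' \in quad_rel J)) ->
  {F : iso (I : QA_category k) J | fwd F 1%N e = e'}.
Proof.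
move=> e1 line e1' line' R.
have [|F FE] := @line_lift _ J _ _ e' e1 line; first by move=> c; rewrite R.
have [|G GE] := @line_lift _ I _ _ e e1' line'; first by move=> c; rewrite R.
have FK : cancel (F 1%N) (G 1%N).
  by move=> v; rewrite -(line v) !lfunZ FE GE.
have GK : cancel (G 1%N) (F 1%N).
  by move=> v; rewrite -(line' v) !lfunZ GE FE.
by exists (gmor_iso FK GK).
Qed.

End Presentations.

(** * Quadratic duality *)

Section Shriek.
Variable k : fieldType.
Local Notation QA := (QA k).

Definition unshr (A : QA) : 'Hom(shriek A 1%N, dual (A 1%N)) :=
  ((pres_gen (orth (quad_rel A)))^-1)%VF.

Definition shrf (A : QA) : 'Hom(dual (A 1%N), shriek A 1%N) :=
  pres_gen (orth (quad_rel A)).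

Lemma shrK (A : QA) : cancel (@shr k A) (unshr A).
Proof. exact/hom_bijK/pres_gen_bij. Qed.

Lemma unshrK (A : QA) : cancel (unshr A) (@shr k A).
Proof. exact/hom_bijVK/pres_gen_bij. Qed.

Lemma shr_ind (A : QA) (Q : shriek A 1%N -> Prop) :
  (forall phi, Q (shr phi)) -> forall u, Q u.
Proof. exact: pres_ind. Qed.

Lemma shrf_rel (A : QA) y :
  (tensmap (shrf A) (shrf A) y \in quad_rel (shriek A)) =
  (y \in orth (quad_rel A)).
Proof. exact: pres_relE. Qed.

Lemma unshr_rel (A : QA) r : (r \in quad_rel (shriek A)) =
  (tensmap (unshr A) (unshr A) r \in orth (quad_rel A)).
Proof.
rewrite -shrf_rel tensmap_comp.
have -> : (shrf A \o unshr A)%VF = \1%VF.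
  by apply/lfunP=> x; rewrite comp_lfunE id_lfunE; apply: unshrK.
by rewrite tensmap_id.
Qed.

Lemma shr_eq (A Z : QA) (f g : gmor (shriek A) Z) :
  (forall phi, f 1%N (shr phi) = g 1%N (shr phi)) -> f = g.
Proof. exact: pres_gmor_eq. Qed.

(** The transpose is adjoint for [tpair], so it carries the orthogonal of R(B) into that of R(A)
    exactly because f carries R(A) into R(B). *)
Lemma shr_map (A B : QA) (f : gmor A B) :
  {F : gmor (shriek B) (shriek A) |
    forall phi, F 1%N (shr phi) = shr (A := A) (phi \o f 1%N)%VF}.
Proof.
have [|F FE] := @pres_lift _ _ (orth (quad_rel B)) (shriek A)
  (shrf A \o transp (f 1%N))%VF; last first.
  exists F => phi; rewrite FE comp_lfunE; congr (shrf A _).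
  by apply/lfunP=> v; rewrite transpE comp_lfunE.
move=> y yR; rewrite -tensmap_comp shrf_rel; apply/mem_orth => r rR.
by rewrite tpair_transp; move/mem_orth: yR; apply; apply: gmor_rel.
Qed.

Definition shriek_map (A B : QA) (f : gmor A B) := sval (shr_map f).

Lemma shriek_mapE (A B : QA) (f : gmor A B) phi :
  shriek_map f 1%N (shr phi) = shr (A := A) (phi \o f 1%N)%VF.
Proof. exact: (svalP (shr_map f)). Qed.

Lemma shriek_map_id (A : QA) : shriek_map (gmor_id A) = gmor_id (shriek A).
Proof.
apply: shr_eq => phi; rewrite shriek_mapE /= id_lfunE; congr shr.
by rewrite comp_lfun1r.
Qed.

Lemma shriek_map_comp (A B C : QA) (g : gmor B C) (f : gmor A B) :
  shriek_map (gmor_comp g f) = gmor_comp (shriek_map f) (shriek_map g).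
Proof.
apply: shr_eq => phi; rewrite /= comp_lfunE !shriek_mapE; congr shr.
by rewrite comp_lfunA.
Qed.

Definition shriek_functor :
    @functor (QA_category k) (opcat (QA_category k)) (@shriek k) :=
  @Functor (QA_category k) (opcat (QA_category k)) (@shriek k)
    shriek_map shriek_map_id (fun X Y Z g f => shriek_map_comp g f).

Definition shriek_cofunctor :
    @functor (opcat (QA_category k)) (QA_category k) (@shriek k) :=
  @Functor (opcat (QA_category k)) (QA_category k) (@shriek k)
    (fun X Y (f : gmor Y X) => shriek_map f) shriek_map_id
    (fun X Y Z (g : gmor Z Y) (f : gmor Y X) => shriek_map_comp f g).

Lemma bidual_fwd (X : QA) : {F : gmor X (shriek (shriek X)) |
  forall x, F 1%N x = shr (A := shriek X) (transp (unshr X) (ev _ x))}.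
Proof.
pose f := (shrf (shriek X) \o (transp (unshr X) \o ev (X 1%N)))%VF.
have fR r : r \in quad_rel X -> tensmap f f r \in quad_rel (shriek (shriek X)).
  move=> rR; rewrite -tensmap_comp shrf_rel -tensmap_comp; apply/mem_orth => s.
  rewrite unshr_rel tpair_transp tpair_ev => /mem_orth; exact.
by exists (gmor_lift fR) => x; rewrite gmor_liftE !comp_lfunE.
Qed.

(** While [bidual_fwd] uses only that R lies in its double orthogonal, this direction needs the
    reverse inclusion [mem_orthK]. *)
Lemma bidual_bwd (X : QA) : {F : gmor (shriek (shriek X)) X |
  forall psi, F 1%N (shr psi) = (ev (X 1%N))^-1%VF (transp (shrf X) psi)}.
Proof.
have [|F FE] := @pres_lift _ _ (orth (quad_rel (shriek X))) X
  ((ev (X 1%N))^-1 \o transp (shrf X))%VF; last first.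
  by exists F => psi; rewrite FE comp_lfunE.
move=> y /mem_orth yR; apply/mem_orthK => z zR.
rewrite -tpair_ev -!tensmap_comp tensmap_comp.
have -> : (ev (X 1%N) \o (ev (X 1%N))^-1)%VF = \1%VF.
  by apply/lfunP=> u; rewrite comp_lfunE id_lfunE hom_bijVK //; apply: ev_bij.
by rewrite tensmap_id tpair_transp; apply: yR; rewrite shrf_rel.
Qed.

Lemma transp_unshr (X : QA) phi :
  transp (shrf X) (transp (unshr X) phi) = phi.
Proof. by apply/lfunP=> f; rewrite !transpE shrK. Qed.

Lemma transp_shrf (X : QA) psi :
  transp (unshr X) (transp (shrf X) psi) = psi.
Proof. by apply/lfunP=> f; rewrite !transpE; congr (psi _); apply: unshrK. Qed.

Lemma bidual_iso (X : QA) : {i : iso (X : QA_category k) (shriek (shriek X)) |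
  forall x, fwd i 1%N x = shr (A := shriek X) (transp (unshr X) (ev _ x))}.
Proof.
have [F FE] := bidual_fwd X; have [G GE] := bidual_bwd X.
have FK : cancel (F 1%N) (G 1%N).
  by move=> x; rewrite FE GE transp_unshr hom_bijK //; apply: ev_bij.
have GK : cancel (G 1%N) (F 1%N).
  elim/pres_ind => psi; rewrite GE FE.
  by rewrite hom_bijVK ?transp_shrf //; apply: ev_bij.
by exists (gmor_iso FK GK).
Qed.

Definition bidual (X : QA) := sval (bidual_iso X).

Lemma bidualE (X : QA) x :
  fwd (bidual X) 1%N x = shr (A := shriek X) (transp (unshr X) (ev _ x)).
Proof. exact: (svalP (bidual_iso X)). Qed.

Lemma bidual_nat (X X' : QA) (f : gmor X X') :
  gmor_comp (fwd (bidual X')) f =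
  gmor_comp (shriek_map (shriek_map f)) (fwd (bidual X)).
Proof.
apply: gmor_eq1 => x; rewrite !gmor_compE.
rewrite !bidualE shriek_mapE; congr shr.
apply/lfunP; elim/pres_ind => phi; rewrite -[pres_gen _ phi]/(shr phi).
rewrite comp_lfunE shriek_mapE.
rewrite !transpE !evE.
by rewrite !shrK comp_lfunE.
Qed.

(** Read in the opposite category, the counit at Y is again the biduality map from Y to its double
    dual, with the two inverse laws exchanged. *)
Definition shriek_quasi_inverse : quasi_inverse shriek_functor.
Proof.
apply: (@QuasiInverse _ _ _ shriek_functor (@shriek k) shriek_cofunctor bidual
  bidual_nat (fun Y => @Iso (opcat (QA_category k)) (shriek (shriek Y)) Y
    (fwd (bidual Y)) (bwd (bidual Y)) (bwdK (bidual Y)) (fwdK (bidual Y)))).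
by move=> Y Y' g; apply: bidual_nat.
Defined.

End Shriek.

(** * Representability of Hom(X . Y, K) and the duals of the units *)

Section Duality.
Variable k : fieldType.
Local Notation QA := (QA k).
Local Notation K := (poly_ring k).

(** Multiplication K_1 x K_1 -> K_2 is that of k. Hence pairing the curried image of r with s is the
    same as multiplying out the image of S23(r (x) s) in K, and orthogonality to R(Y) turns into
    being a relation of K. *)
Lemma curry_pairing (V W : vectType k) (f : 'Hom(tens V W, K 1%N))
    (g : 'Hom(V, dual W)) r s :
  (forall v w, g v w = f (ptens v w) :> k) ->
  tpair W (tensmap g g r) s =
  tlift (gmul (g := K) (add1n 1)) (tensmap f f (S23 _ _ (ptens r s))) :> k.
Proof.
move=> gf; elim/tens_ind: r => [|r r' IHr IHr'|v v'].
- by rewrite ptens0l !lfun0 zero_lfunE.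
- by rewrite ptensDl !lfunD add_lfunE IHr IHr'.
elim/tens_ind: s => [|s s' IHs IHs'|w w'].
- by rewrite ptens0r !lfun0.
- by rewrite ptensDr !lfunD IHs IHs'.
rewrite S23E !tensmapE tpairE !gf tliftE //; exact: gmul_bilin.
Qed.

Lemma curry (X Y : QA) (F : gmor (bullet X Y) K) :
  {G : gmor X (shriek Y) |
    forall x y, unshr Y (G 1%N x) y = F 1%N (bul x y) :> k}.
Proof.
pose c (x : X 1%N) : dual (Y 1%N) := linfun (fun y => F 1%N (bul x y) : k^o).
have cE x y : c x y = F 1%N (bul x y) :> k.
  rewrite linfE // => a u v.
  by rewrite !bulE (pr_bilin _ _ _).2 lfun_lin.
pose g := linfun c.
have gE x y : g x y = F 1%N (bul x y) :> k.
  rewrite linfE ?cE // => a u v; apply/lfunP=> z.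
  rewrite add_lfunE scale_lfunE !cE.
  by rewrite !bulE (pr_bilin _ _ _).1 lfun_lin.
have hR r : r \in quad_rel X ->
    tensmap (shrf Y \o g)%VF (shrf Y \o g)%VF r \in quad_rel (shriek Y).
  move=> rX; rewrite -tensmap_comp shrf_rel; apply/mem_orth => s sY.
  pose f := (F 1%N \o bul_gen X Y)%VF.
  rewrite (@curry_pairing _ _ f) => [|v w]; last by rewrite comp_lfunE gE.
  apply/eqP; rewrite -memv_ker /f -tensmap_comp; apply: gmor_rel.
  by apply: (om_rel (bullet_product k)); rewrite rX sY.
exists (gmor_lift hR) => x y; rewrite gmor_liftE comp_lfunE -gE.
have -> : unshr Y (shrf Y (g x)) = g x by exact: shrK.
by [].
Qed.

Lemma uncurry (X Y : QA) (G : gmor X (shriek Y)) :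
  {F : gmor (bullet X Y) K |
    forall x y, F 1%N (bul x y) = unshr Y (G 1%N x) y :> k}.
Proof.
pose g := (unshr Y \o G 1%N)%VF.
pose h (x : X 1%N) (y : Y 1%N) : K 1%N := g x y.
have bh : bilin h.
  split=> [y|x] a u v; last by rewrite /h lfun_lin.
  by rewrite /h lfun_lin add_lfunE scale_lfunE.
have [|F FE] := pr_lift (bullet_product k) bh.
  move=> x y /andP[xR yR]; rewrite memv_ker.
  have := @curry_pairing _ _ (tlift h) g x y _.
  move=> <- => [|v w]; last by rewrite tliftE.
  apply/eqP; have : tensmap g g x \in orth (quad_rel Y).
    by rewrite -tensmap_comp -unshr_rel; apply: gmor_rel.
  by move=> /mem_orth; apply.
by exists F => x y; rewrite bulE FE /h comp_lfunE.
Qed.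

Lemma shriek_represents (Y : QA) :
  represents (bullet_monoidal k) K Y (shriek Y).
Proof.
exists (fun X (F : gmor (bullet X Y) K) => sval (curry F)).
split=> [X|X X' g f].
  exists (fun G => sval (uncurry G)) => [F|G].
    apply: bul_eq => x y.
    by rewrite (svalP (uncurry _)) (svalP (curry F)).
  apply: gmor_eq1 => x; rewrite -[LHS]unshrK -[RHS]unshrK; congr shr.
  by apply/lfunP=> y; rewrite (svalP (curry _)) (svalP (uncurry G)).
apply: gmor_eq1 => x; rewrite -[LHS]unshrK -[RHS]unshrK; congr shr.
apply/lfunP=> y; rewrite (svalP (curry _)) !cmpE (svalP (curry f)).
by rewrite bul_tmapE idmE.
Qed.

Lemma shriek_duality :
  duality_functor (bullet_monoidal k) K (shriek_functor k).
Proof.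
split; [exact: inhabits (shriek_quasi_inverse k) | exact: shriek_represents].
Qed.

Lemma shriek_line (I : QA) (e : I 1%N) (eps : dual (I 1%N)) :
  eps e = (1 : k) -> (forall v, (eps v : k) *: e = v) ->
  forall u : shriek I 1%N, ((ev _ e \o unshr I)%VF u : k) *: shr eps = u.
Proof.
move=> e1 line u; rewrite -{2}(unshrK u) comp_lfunE evE -[shr eps]/(shrf I eps).
rewrite -lfunZ; congr (shrf I _); apply/lfunP=> v.
by rewrite scale_lfunE -{2}(line v) lfunZ /GRing.scale /= mulrC.
Qed.

Lemma shriek_line_rel (I : QA) (eps : dual (I 1%N)) c :
  (c *: ptens (shr eps) (shr eps) \in quad_rel (shriek I)) =
  (c *: ptens eps eps \in orth (quad_rel I)).
Proof. by rewrite -shrf_rel lfunZ tensmapE. Qed.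

Lemma shriek_dual_numbers :
  {j : iso (shriek (dual_numbers k) : QA_category k) K |
    forall phi, fwd j 1%N (shr phi) = (phi (tau k) : k) *: poly_t k}.
Proof.
have e1 : (ev _ (tau k) \o unshr _)%VF (shr (tau_coef k)) = (1 : k).
  by rewrite comp_lfunE shrK evE tau_coef_tau.
have L := shriek_line (tau_coef_tau k) (@tau_line k).
have [|j jE] := @line_iso k (shriek (dual_numbers k)) K _ _ (poly_t k)
  (t_coef k) e1 L (t_coef_t k) (@t_line k).
  move=> c; rewrite shriek_line_rel.
  apply/idP/idP => [/mem_orth H|/poly_ring_rel ->].
    suff -> : c = 0 by rewrite scale0r mem0v.
    have := H _ (dual_numbers_rel (ptens (tau k) (tau k))).
    rewrite lfunZ scale_lfunE tpairE tau_coef_tau.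
    by move=> E; rewrite -[c]mulr1 -(mulr1 1); apply: E.
  by rewrite scale0r mem0v.
exists j => phi; rewrite -(L (shr phi)) lfunZ jE comp_lfunE shrK evE.
by [].
Qed.

(** No nonzero multiple of t (x) t is a relation, so the orthogonal is everything and the dual
    generator squares to zero. This isomorphism serves as the comparison of units in
    [white_structure]. *)
Lemma shriek_poly_ring :
  {u : iso (shriek K : QA_category k) (dual_numbers k) |
    forall phi, fwd u 1%N (shr phi) = (phi (poly_t k) : k) *: tau k}.
Proof.
have e1 : (ev _ (poly_t k) \o unshr _)%VF (shr (t_coef k)) = (1 : k).
  by rewrite comp_lfunE shrK evE t_coef_t.
have L := shriek_line (t_coef_t k) (@t_line k).
have [|j jE] := @line_iso k (shriek K) (dual_numbers k) _ _ (tau k)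
  (tau_coef k) e1 L (tau_coef_tau k) (@tau_line k).
  move=> c; rewrite shriek_line_rel dual_numbers_rel; apply/mem_orth => r.
  have [d ->] := line_square r (@t_line k).
  by move=> /poly_ring_rel ->; rewrite scale0r lfun0.
exists j => phi; rewrite -(L (shr phi)) lfunZ jE comp_lfunE shrK evE.
by [].
Qed.

End Duality.

(** * The white product *)

Section DualTensor.
Variables (k : fieldType) (X Y V : vectType k).
Variable Theta : 'Hom(tens (dual Y) (dual X), dual V).
Hypothesis Theta_bij : bijective Theta.

Lemma tens_dual_lin (x : X) (y : Y) :
  linear (fun t : tens (dual Y) (dual X) => (t (ev Y y) : dual X) x : k^o).
Proof. by move=> a t t'; rewrite !(add_lfunE, scale_lfunE). Qed.

(** An element t of the tensor product of the duals of Y and X is a map from the bidual of Y to the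
    dual of X, so [t (ev Y y) x] is its value at (y, x). The vector is the one on which each phi
    takes the value of its [Theta] preimage at (y, x). *)
Definition dual_om_vec (x : X) (y : Y) : V :=
  (ev V)^-1%VF (linfun (fun t : tens (dual Y) (dual X) =>
    (t (ev Y y) : dual X) x : k^o) \o Theta^-1)%VF.

Lemma dual_om_vecE x y (phi : dual V) :
  phi (dual_om_vec x y) = (Theta^-1%VF phi (ev Y y) : dual X) x.
Proof.
rewrite -evE hom_bijVK; last exact: ev_bij.
by rewrite comp_lfunE linfE //; apply: tens_dual_lin.
Qed.

(* The transpose of the inverse of Theta, with X and Y swapped.               *)
Definition dual_om : 'Hom(tens X Y, V) := tlift dual_om_vec.

Lemma dual_omE t x y :
  Theta t (dual_om (ptens x y)) = (t (ev Y y) : dual X) x.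
Proof.
rewrite tliftE ?dual_om_vecE ?hom_bijK //.
by split=> [y'|x'] a u v; apply: dual_inj => phi;
  rewrite lfun_lin !dual_om_vecE !lfun_lin // add_lfunE scale_lfunE.
Qed.

Lemma dual_om_tens g f t : Theta (ptens g f) (dual_om t) = g (t f).
Proof.
elim/tens_ind: t => [|t t' IHt IHt'|x y].
- by rewrite zero_lfunE !lfun0.
- by rewrite add_lfunE !lfunD IHt IHt'.
by rewrite dual_omE !ptensE scale_lfunE evE lfunZ; apply: mulrC.
Qed.

(** Injectivity: the functionals [Theta (ptens g f)] already separate tensors. Surjectivity: a
    functional killing the image is [Theta t] with t zero as a form on Y and X. *)
Lemma dual_om_bij : bijective dual_om.
Proof.
have inj : lker dual_om == 0%VS.
  apply/lker0P => t t' tt'; apply/lfunP => f; apply: dual_inj => g.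
  by rewrite -!dual_om_tens tt'.
exists (dual_om^-1)%VF; first exact: lker0_lfunK.
move=> w; apply: limg_lfunVK; apply: dual_sep => phi phi0.
rewrite -(hom_bijVK Theta_bij phi); set t := (_ phi).
suff -> : t = 0 by rewrite lfun0 zero_lfunE.
apply/lfunP => l; rewrite zero_lfunE -(hom_bijVK (ev_bij Y) l).
apply/lfunP => x; rewrite zero_lfunE -dual_omE /t hom_bijVK //.
by apply: phi0; rewrite memv_img ?memvf.
Qed.

(** [Theta] and [dual_om] are adjoint, so their squares pair factorwise: up to the rearrangement, g
    is paired with the Y part of z and f with its X part. *)
Lemma dual_om_square g f z :
  tpair _ (tensmap Theta Theta (S23 _ _ (ptens g f)))
    (tensmap dual_om dual_om (S23 _ _ z)) = tpair _ g (z (tpair _ f)).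
Proof.
elim/tens_ind: z => [|z z' IHz IHz'|a b].
- by rewrite zero_lfunE !lfun0.
- by rewrite add_lfunE !lfunD IHz IHz'.
rewrite ptensE lfunZ.
elim/tens_ind: g => [|g g' IHg IHg'|g g'].
- by rewrite !(lfun0, ptens0l) !zero_lfunE scaler0.
- by rewrite !(lfunD, ptensDl) !add_lfunE IHg IHg' scalerDr.
elim/tens_ind: f => [|f f' IHf IHf'|f f'].
- by rewrite !(lfun0, ptens0r) !zero_lfunE scale0r.
- by rewrite !(lfunD, ptensDr) !add_lfunE IHf IHf' scalerDl.
elim/tens_ind: a => [|a a' IHa IHa'|x x'].
- by rewrite !(lfun0, ptens0l) scale0r.
- by rewrite !(lfunD, ptensDl) IHa IHa' scalerDl.
elim/tens_ind: b => [|b b' IHb IHb'|y y'].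
- by rewrite !(lfun0, ptens0r) scaler0.
- by rewrite !(lfunD, ptensDr) IHb IHb' scalerDr.
rewrite !(tensmapE, S23E) !tpairE !dual_om_tens !ptensE !lfunZ.
exact: mulrACA.
Qed.

Variables (RX : {vspace tens X X}) (RY : {vspace tens Y Y}).
Variable RV : {vspace tens V V}.
Hypothesis orthV :
  orth RV = (tensmap Theta Theta @: (S23 _ _ @: tensv (orth RY) (orth RX)))%VS.

Lemma dual_om_rel :
  (tensmap dual_om dual_om @: (S23 _ _ @: (tensv RX fullv + tensv fullv RY)))%VS
  = RV.
Proof.
apply/eqP; rewrite eqEsubv; apply/andP; split; apply/subvP => w.
  rewrite -limg_comp => /memv_imgP[z zQ ->]; move: z zQ.
  suff /subvP S : (tensv RX fullv + tensv fullv RY <=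
      (tensmap dual_om dual_om \o S23 _ _) @^-1: RV)%VS.
    by move=> z /S; rewrite -memv_preim.
  suff S a b : a \in RX \/ b \in RY ->
      (tensmap dual_om dual_om \o S23 _ _)%VF (ptens a b) \in RV.
    rewrite subv_add; apply/andP; split; apply/tensv_subP => a b aR bR;
      rewrite -memv_preim; apply: S; [by left | by right].
  move=> ab; rewrite comp_lfunE; set t := tensmap _ _ _.
  apply/mem_orthK => psi; rewrite orthV -limg_comp => /memv_imgP[z zQ ->].
  (* The functional pairing a varying element with the fixed t: its kernel is a subspace, so it
     suffices to test it on tensors r (x) s that span the orthogonal of RV. *)
  pose l : dual (tens (tens (dual Y) (dual Y)) (tens (dual X) (dual X))) :=
    (ev _ t \o (tpair _ \o (tensmap Theta Theta \o S23 _ _)))%VF.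
  have lE u : l u = tpair _ ((tensmap Theta Theta \o S23 _ _)%VF u) t.
    rewrite [LHS]comp_lfunE evE; set q := (_ u); set q' := tpair _ _.
    by have -> : q = q' by exact: comp_lfunE.
  rewrite -lE; apply/eqP; rewrite -memv_ker.
  suff /subvP : (tensv (orth RY) (orth RX) <= lker l)%VS by exact.
  apply/tensv_subP => r s /mem_orth rR /mem_orth sR.
  rewrite memv_ker lE comp_lfunE dual_om_square ptensE lfunZ; apply/eqP.
  by case: ab => [/sR|/rR] ->; rewrite ?scale0r ?scaler0.
(* Conversely, by [tensv_sep] it is enough to pair w with functionals F and G killing RX and RY.
   They come from elements of [orth RX] and [orth RY], whose rearranged product lies in [orth RV]
   and so kills w. *)
move=> wR; have [t _ tK] := tensmap_sq_bij dual_om_bij.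
rewrite -(tK w) memv_img //; have [z zE] := S23_surj (t w).
rewrite zE memv_img //; apply: tensv_sep => F G FR GR.
have [f fF] := tpair_surj F; have [g gG] := tpair_surj G.
rewrite -fF -gG -dual_om_square -zE tK.
move/mem_orthK: wR; apply; rewrite orthV; do 2!apply: memv_img.
by apply: mem_tensv; apply/mem_orth => r rR; rewrite ?gG ?GR // fF FR.
Qed.

End DualTensor.

Section White.
Variable k : fieldType.
Local Notation QA := (QA k).
Local Notation K := (poly_ring k).
Local Notation M := (bullet_monoidal k).

Section Pairing.

(** The contraction l (x) 1 of the first factor; letting l vary recovers the element, since (P .
    Q)_1 is a space of maps on the dual of P_1. *)
Definition slice (P Q : QA) (l : dual (P 1%N)) : 'Hom(bullet P Q 1%N, Q 1%N) :=
  linfun (fun u => (bul_gen P Q)^-1%VF u l).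

Lemma slice_lin (P Q : QA) (l : dual (P 1%N)) :
  linear (fun u : bullet P Q 1%N => (bul_gen P Q)^-1%VF u l).
Proof. by move=> a u v; rewrite lfun_lin add_lfunE scale_lfunE. Qed.

Lemma sliceE (P Q : QA) l p q : slice Q l (bul (A := P) p q) = (l p : k) *: q.
Proof.
by rewrite linfE ?hom_bijK ?ptensE //; [apply: bul_gen_bij|apply: slice_lin].
Qed.

Lemma slice_inj (P Q : QA) (u v : bullet P Q 1%N) :
  (forall l, slice Q l u = slice Q l v) -> u = v.
Proof.
move=> H; apply: (can_inj (hom_bijVK (bul_gen_bij _ _))); apply/lfunP=> l.
by have := H l; rewrite !linfE //; apply: slice_lin.
Qed.

Definition sev (A : QA) (a : A 1%N) : dual (shriek A 1%N) :=
  (ev _ a \o unshr A)%VF.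

Lemma sevE (A : QA) (a : A 1%N) p : sev a p = unshr A p a.
Proof. by rewrite comp_lfunE evE. Qed.

Lemma sev_shr (A : QA) (a : A 1%N) phi : sev a (shr phi) = phi a.
Proof. by rewrite sevE shrK. Qed.

Lemma sev_surj (A : QA) (l : dual (shriek A 1%N)) : exists a, l = sev a.
Proof.
have [g _ gK] := ev_bij (A 1%N); exists (g (l \o shrf A)%VF).
apply/lfunP; elim/shr_ind => phi;
have /lfunP/(_ phi) := gK (l \o shrf A)%VF.
by rewrite sev_shr evE comp_lfunE.
Qed.

(** The pairing of x (x) y with (Y^! . X^!)_1, factors reversed as in the definition of the white
    product. *)
Definition bpair (X Y : QA) (x : X 1%N) (y : Y 1%N) :
    dual (bullet (shriek Y) (shriek X) 1%N) :=
  (sev x \o slice (shriek X) (sev y))%VF.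

Lemma bpair_slice (X Y : QA) (x : X 1%N) (y : Y 1%N) u :
  bpair x y u = sev x (slice (shriek X) (sev y) u).
Proof. exact: comp_lfunE. Qed.

Lemma bpairE (X Y : QA) (x : X 1%N) (y : Y 1%N) p q :
  bpair x y (bul p q) = (sev y p : k) * sev x q.
Proof. by rewrite bpair_slice sliceE lfunZ. Qed.

Lemma bpair_inj (X Y : QA) (u v : bullet (shriek Y) (shriek X) 1%N) :
  (forall x y, bpair x y u = bpair x y v) -> u = v.
Proof.
move=> H; apply: slice_inj => l; have [y ->] := sev_surj l.
apply: dual_inj => m; have [x ->] := sev_surj m.
by have := H x y; rewrite !bpair_slice.
Qed.

Lemma bpair_map (X X' Y Y' : QA) (f : gmor X X') (g : gmor Y Y') x y u :
  bpair x y (tmap M (shriek_map g) (shriek_map f) 1%N u) =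
  bpair (f 1%N x) (g 1%N y) u.
Proof.
rewrite -[LHS]comp_lfunE; move: u.
apply: bul_hom_eq => p q.
rewrite comp_lfunE bul_tmapE !bpairE -(unshrK p) -(unshrK q).
by rewrite !shriek_mapE !sev_shr !comp_lfunE.
Qed.

Lemma slice_mapr (P Q Q' : QA) l (g : gmor Q Q') (u : bullet P Q 1%N) :
  slice Q' l (tmap M (idm P) g 1%N u) = g 1%N (slice Q l u).
Proof.
rewrite -[LHS]comp_lfunE -[RHS]comp_lfunE; move: u.
apply: bul_hom_eq => p q.
by rewrite !comp_lfunE bul_tmapE !sliceE idmE lfunZ.
Qed.

Lemma slice_mapl (P P' Q : QA) l (f : gmor P P') (u : bullet P Q 1%N) :
  slice Q l (tmap M f (idm Q) 1%N u) = slice Q (l \o f 1%N)%VF u.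
Proof.
rewrite -[LHS]comp_lfunE; move: u.
apply: bul_hom_eq => p q.
by rewrite !comp_lfunE bul_tmapE !sliceE idmE comp_lfunE.
Qed.

Lemma slice_assoc (X Y Z : QA) (x : X 1%N) (y : Y 1%N) (z : Z 1%N) u :
  bpair x y (slice _ (sev z)
    (fwd (assoc M (shriek Z) (shriek Y) (shriek X)) 1%N u)) =
  sev x (slice _ (bpair y z) u).
Proof.
rewrite -[slice _ _ _]comp_lfunE -[LHS]comp_lfunE -[RHS]comp_lfunE; move: u.
apply: bul_hom_eq3 => p q r.
rewrite !comp_lfunE bul_assocE !sliceE !lfunZ bpairE.
rewrite sliceE !lfunZ; exact: mulrA.
Qed.

End Pairing.

Section Comparison.
Variable W : QA -> QA -> QA.

(* Only D(W X Y) = DY . DX is used about the white product W; keeping W       *)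
(* abstract also stops unification from unfolding quotients of tensor         *)
(* algebras.                                                                  *)
Variable wcmp : forall X Y : QA,
  gmor (shriek (W X Y)) (bullet (shriek Y) (shriek X)).
Variable wcmp_inv : forall X Y : QA,
  gmor (bullet (shriek Y) (shriek X)) (shriek (W X Y)).
Hypothesis wcmpK : forall X Y, cancel (wcmp X Y 1%N) (wcmp_inv X Y 1%N).
Hypothesis wcmp_invK : forall X Y, cancel (wcmp_inv X Y 1%N) (wcmp X Y 1%N).

Definition Theta (X Y : QA) :
    'Hom(tens (dual (Y 1%N)) (dual (X 1%N)), dual (W X Y 1%N)) :=
  (unshr (W X Y) \o wcmp_inv X Y 1%N
    \o (bul_gen _ _ \o tensmap (shrf Y) (shrf X)))%VF.

Lemma ThetaE (X Y : QA) t : Theta X Y t = unshr (W X Y)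
  (wcmp_inv X Y 1%N (bul_gen _ _ (tensmap (shrf Y) (shrf X) t))).
Proof.
rewrite [LHS]comp_lfunE [LHS]comp_lfunE; congr (unshr _ (wcmp_inv _ _ _ _)).
exact: comp_lfunE.
Qed.

Lemma wcmp_Theta (X Y : QA) t :
  wcmp X Y 1%N (shr (Theta X Y t)) =
  bul_gen _ _ (tensmap (shrf Y) (shrf X) t).
Proof. by rewrite ThetaE (unshrK (wcmp_inv X Y 1%N _)); apply: wcmp_invK. Qed.

Lemma Theta_bij (X Y : QA) : bijective (Theta X Y).
Proof.
apply: hom_bij_comp; first apply: hom_bij_comp.
- by exists (@shr k (W X Y)); [exact: unshrK | exact: shrK].
- by exists (wcmp X Y 1%N); [exact: wcmp_invK | exact: wcmpK].
apply: hom_bij_comp; first exact: bul_gen_bij.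
by apply: tensmap_bij; apply: pres_gen_bij.
Qed.

Lemma Theta_square (X Y : QA) g f :
  tensmap (Theta X Y) (Theta X Y) (S23 _ _ (ptens g f)) =
  tensmap (unshr (W X Y) \o wcmp_inv X Y 1%N)%VF
    (unshr (W X Y) \o wcmp_inv X Y 1%N)%VF
    (tensmap (bul_gen _ _) (bul_gen _ _) (S23 _ _
      (ptens (tensmap (shrf Y) (shrf Y) g) (tensmap (shrf X) (shrf X) f)))).
Proof. by rewrite -tensmap_S23 (tensmap_comp (bul_gen _ _)) tensmap_comp. Qed.

(** W^! is isomorphic to Y^! . X^! and isomorphisms match relations, so the relations of W are first
    known through their orthogonal; [dual_om_rel] then recovers them. *)
Lemma orth_white_rel (X Y : QA) : orth (quad_rel (W X Y)) =
  (tensmap (Theta X Y) (Theta X Y) @: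
    (S23 _ _ @: tensv (orth (quad_rel Y)) (orth (quad_rel X))))%VS.
Proof.
set T := RHS; pose h := (unshr (W X Y) \o wcmp_inv X Y 1%N)%VF.
apply/eqP; rewrite eqEsubv; apply/andP; split; apply/subvP => psi.
  rewrite -shrf_rel => /(gmor_rel (wcmp X Y)); set v := tensmap _ _ _ => vR.
  have -> : psi = tensmap h h v.
    rewrite /v !tensmap_comp; set q := (_ \o _)%VF.
    suff -> : q = \1%VF by rewrite tensmap_id.
    apply/lfunP=> phi; rewrite id_lfunE.
    do 3![rewrite [LHS]comp_lfunE].
    exact: (etrans (congr1 (unshr (W X Y)) (wcmpK (shr phi))) (shrK phi)).
  suff /subvP/(_ v vR) : (quad_rel (bullet (shriek Y) (shriek X)) <=
      tensmap h h @^-1: T)%VS by rewrite -memv_preim.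
  apply: (om_rel_min (bullet_product k)) => r s /andP[rR sR].
  rewrite -memv_preim.
  rewrite -(hom_bijVK (tensmap_sq_bij (pres_gen_bij _)) r).
  rewrite -(hom_bijVK (tensmap_sq_bij (pres_gen_bij _)) s).
  rewrite -[tensmap h h _]Theta_square; do 2!apply: memv_img.
  apply: mem_tensv; rewrite -shrf_rel.
    by rewrite [X in X \in _](hom_bijVK (tensmap_sq_bij (pres_gen_bij _)) r).
  by rewrite [X in X \in _](hom_bijVK (tensmap_sq_bij (pres_gen_bij _)) s).
rewrite /T -limg_comp => /memv_imgP[z zQ ->]; move: z zQ.
suff /subvP S : (tensv (orth (quad_rel Y)) (orth (quad_rel X)) <=
    (tensmap (Theta X Y) (Theta X Y) \o S23 _ _) @^-1:
    orth (quad_rel (W X Y)))%VS.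
  by move=> z /S; rewrite -memv_preim.
apply/tensv_subP => g f gR fR; rewrite -memv_preim comp_lfunE Theta_square.
rewrite -tensmap_comp -unshr_rel; apply: gmor_rel.
by apply: (om_rel (bullet_product k)); rewrite !shrf_rel gR fR.
Qed.

Definition om (X Y : QA) : 'Hom(tens (X 1%N) (Y 1%N), W X Y 1%N) :=
  dual_om (Theta X Y).

Lemma om_presents (X Y : QA) : presents (white_rel X Y) (om X Y).
Proof.
split; first exact/dual_om_bij/Theta_bij.
exact: (dual_om_rel (Theta_bij X Y) (orth_white_rel X Y)).
Qed.

Lemma bpair_gen (X Y : QA) (x : X 1%N) (y : Y 1%N) t :
  bpair x y (bul_gen _ _ (tensmap (shrf Y) (shrf X) t)) =
  (t (ev _ y) : dual (X 1%N)) x.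
Proof.
elim/tens_ind: t => [|t t' IHt IHt'|g f].
- by rewrite !lfun0 !zero_lfunE.
- by rewrite !lfunD !add_lfunE IHt IHt'.
rewrite tensmapE [LHS]bpairE ptensE scale_lfunE evE.
by rewrite (sev_shr y g) (sev_shr x f).
Qed.

(** Evaluating a functional at [om] of x (x) y is pairing x (x) y with its image under the
    comparison. All later identities about W are checked by this translation. *)
Lemma omE (X Y : QA) (x : X 1%N) (y : Y 1%N) (phi : dual (W X Y 1%N)) :
  phi (om X Y (ptens x y)) = bpair x y (wcmp X Y 1%N (shr phi)).
Proof.
have [t _ tK] := Theta_bij X Y.
rewrite -(tK phi) wcmp_Theta bpair_gen; apply: dual_omE; exact: Theta_bij.
Qed.

Lemma wmap_om (X X' Y Y' : QA) (f : gmor X X') (g : gmor Y Y')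
    (F : gmor (W X Y) (W X' Y')) x y :
  (forall u, wcmp X Y 1%N (shriek_map F 1%N u) =
    tmap M (shriek_map g) (shriek_map f) 1%N (wcmp X' Y' 1%N u)) ->
  F 1%N (om X Y (ptens x y)) = om X' Y' (ptens (f 1%N x) (g 1%N y)).
Proof.
move=> FE; apply: dual_inj => phi; rewrite -[LHS](comp_lfunE phi (F 1%N)) !omE.
by rewrite -(shriek_mapE F phi) FE bpair_map.
Qed.

Section Structure.
Variable N : @monoidal (QA_category k) W K.
Hypothesis assocN : forall (X Y Z : QA) x y z,
  fwd (assoc N X Y Z) 1%N (om (W X Y) Z (ptens (om X Y (ptens x y)) z)) =
  om X (W Y Z) (ptens x (om Y Z (ptens y z))).
Hypothesis lunitN : forall (X : QA) x,
  fwd (lunit N X) 1%N (om K X (ptens (poly_t k) x)) = x.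
Hypothesis runitN : forall (X : QA) x,
  fwd (runit N X) 1%N (om X K (ptens x (poly_t k))) = x.

(** Paired with x, y, z, the two sides become phi evaluated at the two bracketings of x (x) y (x) z,
    the left one moved by the associator of N; [assocN] equates them. *)
Lemma white_assoc (X Y Z : QA) :
  gmor_comp (tmap M (idm (shriek Z)) (wcmp X Y))
    (gmor_comp (wcmp (W X Y) Z) (shriek_map (fwd (assoc N X Y Z))))
  = gmor_comp (fwd (assoc M (shriek Z) (shriek Y) (shriek X)))
      (gmor_comp (tmap M (wcmp Y Z) (idm (shriek X))) (wcmp X (W Y Z))).
Proof.
apply: shr_eq => phi; apply: slice_inj => l; have [z ->] := sev_surj l.
apply: bpair_inj => x y; rewrite !gmor_compE slice_mapr slice_assoc slice_mapl.
rewrite shriek_mapE.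
set v := wcmp (W X Y) Z 1%N _; set v' := wcmp X (W Y Z) 1%N _.
rewrite -(unshrK (slice _ _ v)) -omE -sevE -bpair_slice /v -omE comp_lfunE.
rewrite assocN.
have -> : (bpair y z \o wcmp Y Z 1%N)%VF = sev (om Y Z (ptens y z)).
  apply/lfunP; elim/shr_ind => psi.
  by rewrite sev_shr comp_lfunE omE.
by rewrite -bpair_slice /v' -omE.
Qed.

(** Duality reverses the factors, so the left unit of N corresponds to the right unit of M. Since
    [u] evaluates functionals at t, the composite of black constraints is the pairing with t in the
    first slot, which is what [key] records. *)
Lemma white_lunit (u : iso (shriek K : QA_category k) (dual_numbers k)) X :
  (forall phi, fwd u 1%N (shr phi) = (phi (poly_t k) : k) *: tau k) ->
  gmor_comp (fwd (runit M (shriek X)))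
    (gmor_comp (tmap M (idm (shriek X)) (fwd u))
       (gmor_comp (wcmp K X) (shriek_map (fwd (lunit N X))))) =
  gmor_id (shriek X).
Proof.
move=> uE; apply: shr_eq => phi; rewrite -[LHS]unshrK -[RHS]unshrK.
congr shr; apply/lfunP => x; rewrite !gmor_compE idmE shrK shriek_mapE.
have key v : unshr X (fwd (runit M (shriek X)) 1%N
    (tmap M (idm (shriek X)) (fwd u) 1%N v)) x = bpair (poly_t k) x v.
  elim/bul_ind: v => [|v v' IHv IHv'|p q].
  - by rewrite !lfun0 zero_lfunE.
  - by rewrite !lfunD add_lfunE IHv IHv'.
  rewrite bul_tmapE idmE -(unshrK q) uE.
  rewrite bulE /pr ptensZr lfunZ bul_genE lfunZ bul_runitE.
  rewrite !lfunZ bpairE scale_lfunE sev_shr sevE.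
  exact: mulrC.
by rewrite key -omE comp_lfunE lunitN.
Qed.

Lemma white_runit (u : iso (shriek K : QA_category k) (dual_numbers k)) X :
  (forall phi, fwd u 1%N (shr phi) = (phi (poly_t k) : k) *: tau k) ->
  gmor_comp (fwd (lunit M (shriek X)))
    (gmor_comp (tmap M (fwd u) (idm (shriek X)))
       (gmor_comp (wcmp X K) (shriek_map (fwd (runit N X))))) =
  gmor_id (shriek X).
Proof.
move=> uE; apply: shr_eq => phi; rewrite -[LHS]unshrK -[RHS]unshrK.
congr shr; apply/lfunP => x; rewrite !gmor_compE idmE shrK shriek_mapE.
have key v : unshr X (fwd (lunit M (shriek X)) 1%N
    (tmap M (fwd u) (idm (shriek X)) 1%N v)) x = bpair x (poly_t k) v.
  elim/bul_ind: v => [|v v' IHv IHv'|p q].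
  - by rewrite !lfun0 zero_lfunE.
  - by rewrite !lfunD add_lfunE IHv IHv'.
  rewrite bul_tmapE idmE -(unshrK p) uE.
  rewrite bulE /pr ptensZl lfunZ bul_genE lfunZ bul_lunitE.
  by rewrite !lfunZ bpairE scale_lfunE sev_shr sevE.
by rewrite key -omE comp_lfunE runitN.
Qed.

End Structure.

End Comparison.

(** Naturality is supplied for the forward counit, whereas [white_cmp] is its inverse; this passes
    from one to the other. *)
Lemma conjugate_nat (A A' B B' : QA) (w : gmor A B) (w_inv : gmor B A)
    (w' : gmor A' B') (w'_inv : gmor B' A') (F : gmor A' A) (h : gmor B' B) :
  cancel (w' 1%N) (w'_inv 1%N) -> cancel (w_inv 1%N) (w 1%N) ->
  gmor_comp w_inv h = gmor_comp F w'_inv ->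
  forall u, w 1%N (F 1%N u) = h 1%N (w' 1%N u).
Proof.
move=> w'K wK E u; rewrite -{1}(w'K u) -[F 1%N _]gmor_compE -E gmor_compE.
exact: wK.
Qed.

Variable E : quasi_inverse (shriek_functor k).
Local Notation W := (white (@bullet k) E).

Definition wcmp (X Y : QA) :
    gmor (shriek (W X Y)) (bullet (shriek Y) (shriek X)) :=
  white_cmp (@bullet k) E X Y.

Definition wcmp_inv (X Y : QA) :
    gmor (bullet (shriek Y) (shriek X)) (shriek (W X Y)) :=
  unop (fwd (qcounit E (bullet (shriek Y) (shriek X)))).

Lemma wcmpK (X Y : QA) : cancel (wcmp X Y 1%N) (wcmp_inv X Y 1%N).
Proof.
move=> u; rewrite -gmor_compE.
have -> : gmor_comp (wcmp_inv X Y) (wcmp X Y) = gmor_id _.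
  exact: (fwdK (qcounit E (bullet (shriek Y) (shriek X)))).
exact: id_lfunE.
Qed.

Lemma wcmp_invK (X Y : QA) : cancel (wcmp_inv X Y 1%N) (wcmp X Y 1%N).
Proof.
move=> u; rewrite -gmor_compE.
have -> : gmor_comp (wcmp X Y) (wcmp_inv X Y) = gmor_id _.
  exact: (bwdK (qcounit E (bullet (shriek Y) (shriek X)))).
exact: id_lfunE.
Qed.

Definition qinv_map (A B : QA) (h : gmor B A) : gmor (E A) (E B) :=
  @fmap _ _ _ (qinv_functor E) A B h.

Lemma wcmp_inv_nat (X X' Y Y' : QA)
    (h : gmor (bullet (shriek Y') (shriek X')) (bullet (shriek Y) (shriek X))) :
  gmor_comp (wcmp_inv X Y) h =
  gmor_comp (shriek_map (qinv_map h)) (wcmp_inv X' Y').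
Proof.
exact: (@qcounit_nat _ _ _ _ E (bullet (shriek Y) (shriek X))
  (bullet (shriek Y') (shriek X')) h).
Qed.

Lemma wcmp_nat (X X' Y Y' : QA)
    (h : gmor (bullet (shriek Y') (shriek X')) (bullet (shriek Y) (shriek X)))
    u :
  wcmp X Y 1%N (shriek_map (qinv_map h) 1%N u) = h 1%N (wcmp X' Y' 1%N u).
Proof.
exact: (conjugate_nat (@wcmpK X' Y') (@wcmp_invK X Y) (wcmp_inv_nat h)).
Qed.

Definition white_om := om wcmp_inv.

Lemma white_om_presents (X Y : QA) : presents (white_rel X Y) (white_om X Y).
Proof. exact: (om_presents wcmpK wcmp_invK). Qed.

(** The constraints of N are fixed by their formulas on [white_om], and so is the structure
    transported along the duality. Hence a structure built from the presentation alone is recognised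
    as the transported one. *)
Lemma white_structureP (N : @monoidal (QA_category k) W K) :
  (forall (X X' Y Y' : QA) (f : gmor X X') (g : gmor Y Y') x y,
    tmap N f g 1%N (white_om X Y (ptens x y)) =
    white_om X' Y' (ptens (f 1%N x) (g 1%N y))) ->
  (forall (X Y Z : QA) x y z,
    fwd (assoc N X Y Z) 1%N
      (white_om (W X Y) Z (ptens (white_om X Y (ptens x y)) z)) =
    white_om X (W Y Z) (ptens x (white_om Y Z (ptens y z)))) ->
  (forall (X : QA) x,
    fwd (lunit N X) 1%N (white_om K X (ptens (poly_t k) x)) = x) ->
  (forall (X : QA) x,
    fwd (runit N X) 1%N (white_om X K (ptens x (poly_t k))) = x) ->
  white_structure M N.
Proof.
move=> tmapN assocN lunitN runitN; split.
- move=> X X' Y Y' f g.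
  apply: (pr_eq (white_product white_om_presents)) => x y.
  apply: (etrans (tmapN _ _ _ _ f g x y)); apply: esym.
  have := @wmap_om _ _ _ wcmpK wcmp_invK X X' Y Y' f g _ x y
    (@wcmp_nat X X' Y Y' (tmap M (shriek_map g) (shriek_map f))).
  exact.
- move=> X Y Z; exact: (white_assoc wcmpK wcmp_invK assocN).
have [u uE] := shriek_poly_ring k; exists u => X; split.
  exact: (white_lunit wcmpK wcmp_invK lunitN).
exact: (white_runit wcmpK wcmp_invK runitN).
Qed.

End White.

(** * The canonical morphism from the black to the white product *)

Lemma bullet_white_rel (k : fieldType) (A B : QA k) :
  (bullet_rel A B <= white_rel A B)%VS.
Proof.
apply: limgS; apply/tensv_subP => x y xR yR.
by apply: (subvP (addvSl _ _)); apply: mem_tensv; rewrite ?memvf.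
Qed.

(** If x and y are both relations then at least one is, so the identity of A_1 (x) B_1 carries black
    relations to white ones. *)
Lemma black_to_white (k : fieldType) (P : QA k -> QA k -> QA k)
    (om : forall A B : QA k, 'Hom(tens (A 1%N) (B 1%N), P A B 1%N)) :
  (forall A B, presents (white_rel A B) (om A B)) ->
  forall A B : QA k, {F : gmor (bullet A B) (P A B) |
    forall a b, F 1%N (bul a b) = om A B (ptens a b)}.
Proof.
move=> /white_product om_product A B.
have bh : bilin (fun (a : A 1%N) (b : B 1%N) => om A B (ptens a b)).
  exact: (pr_bilin om A B).
have [|F FE] := pr_lift (bullet_product k) bh; last by exists F.
move=> x y /andP[xR yR].
have -> : tlift (fun (a : A 1%N) (b : B 1%N) => om A B (ptens a b)) = om A B.
  by apply: tens_ext => a b; rewrite tliftE.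
by apply: (om_rel om_product); rewrite xR.
Qed.

Theorem proposition2p2 (k : fieldType) :
  exists M : @monoidal (QA_category k) (@bullet k) (dual_numbers k),
    [/\ (forall (A A' B B' : QA k) (f : mor A A') (g : mor B B')
            (a : A 1%N) (b : B 1%N),
          tmap M f g 1%N (bul a b) = bul (f 1%N a) (g 1%N b)),
        (forall (A B C : QA k) (a : A 1%N) (b : B 1%N) (c : C 1%N),
          fwd (assoc M A B C) 1%N (bul (bul a b) c) = bul a (bul b c)),
        (forall (A : QA k) (a : A 1%N),
          fwd (lunit M A) 1%N (bul (tau k) a) = a)
      & (forall (A : QA k) (a : A 1%N),
          fwd (runit M A) 1%N (bul a (tau k)) = a)] /\
    exists D : @functor (QA_category k) (opcat (QA_category k)) (@shriek k),
      [/\ (forall (A B : QA k) (f : mor A B) (phi : dual (B 1%N)),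
            unop (fmap D f) 1%N (shr phi) = shr (A := A) (phi \o f 1%N)%VF),
          (exists j : iso (shriek (dual_numbers k)) (poly_ring k),
            forall phi : dual (dual_numbers k 1%N),
              fwd j 1%N (shr phi) = (phi (tau k) : k) *: poly_t k),
          duality_functor M (poly_ring k) D
        & grothendieck_verdier M (poly_ring k)] /\
      forall E : quasi_inverse D,
        exists (W : monoidal (white (@bullet k) E) (poly_ring k))
            (om : forall A B : QA k,
              'Hom(tens (A 1%N) (B 1%N), white (@bullet k) E A B 1%N))
            (kap : forall A B : QA k,
              mor (bullet A B) (white (@bullet k) E A B : QA k)),
          [/\ white_structure M W,
              (forall A B : QA k, presents (white_rel A B) (om A B)),
              (forall (A A' B B' : QA k) (f : mor A A') (g : mor B B')
                  (a : A 1%N) (b : B 1%N),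
                tmap W f g 1%N (om A B (ptens a b))
                = om A' B' (ptens (f 1%N a) (g 1%N b))),
              (forall (A B C : QA k) (a : A 1%N) (b : B 1%N) (c : C 1%N),
                fwd (assoc W A B C) 1%N
                  (om (white (@bullet k) E A B) C (ptens (om A B (ptens a b)) c))
                = om A (white (@bullet k) E B C)
                    (ptens a (om B C (ptens b c))))
            & (forall (A : QA k) (a : A 1%N),
                fwd (lunit W A) 1%N (om (poly_ring k) A (ptens (poly_t k) a)) = a /\
                fwd (runit W A) 1%N (om A (poly_ring k) (ptens a (poly_t k))) = a)]
          /\
          [/\ (forall A B : QA k, (bullet_rel A B <= white_rel A B)%VS),
              (forall (A B : QA k) (a : A 1%N) (b : B 1%N),
                kap A B 1%N (bul a b) = om A B (ptens a b)),
              (forall (A A' B B' : QA k) (f : mor A A') (g : mor B B'),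
                cmp (kap A' B') (tmap M f g) = cmp (tmap W f g) (kap A B))
            & (forall A B C : QA k,
                cmp (fwd (assoc W A B C))
                  (cmp (kap (white (@bullet k) E A B) C)
                     (tmap M (kap A B) (idm C)))
                = cmp (kap A (white (@bullet k) E B C))
                    (cmp (tmap M (idm A) (kap B C))
                       (fwd (assoc M A B C))))].
Proof.
exists (bullet_monoidal k); split; first exact: bullet_monoidalP.
exists (shriek_functor k); split.
  split.
  - exact: shriek_mapE.
  - by have [j jE] := shriek_dual_numbers k; exists j.
  - exact: shriek_duality.
  - exists (@shriek k), (shriek_functor k); exact: shriek_duality.
move=> E; have Wpres := @white_om_presents k E.
(* The structure comes from the presentation of E(DB . DA) with the connective [orb], whose unit is
   k[t]; transport along E is verified afterwards. *)
have [N [NT NA NL NR]] := product_monoidal (white_product Wpres)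
  (poly_ring_unit k).
exists N, (white_om E), (fun A B => sval (black_to_white Wpres A B)).
have kapE (A B : QA k) (a : A 1%N) (b : B 1%N) :
    sval (black_to_white Wpres A B) 1%N (bul a b) = white_om E A B (ptens a b).
  exact: (svalP (black_to_white Wpres A B)).
split; split.
- exact: (white_structureP NT NA NL NR).
- exact: Wpres.
- exact: NT.
- exact: NA.
- by move=> A a; split; [exact: NL | exact: NR].
- exact: bullet_white_rel.
- exact: kapE.
- move=> A A' B B' f g; apply: bul_eq => a b.
  rewrite !cmpE bul_tmapE !kapE; exact/esym/NT.
(* On a (x) b (x) c both composites rebracket and replace black products by white ones, so the
   associator formula for N finishes. *)
move=> A B C; apply: (pr_eq3 (bullet_product k)) => a b c.
rewrite -!bulE !cmpE bul_assocE !bul_tmapE !idmE !kapE.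
exact: NA.
Qed.
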